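(* Let $c\in(3/2,5/2]$ and $f_0>0$ be fixed, and $f_j=0$ for $j>0$. For each $\nu>0$ let $a^\nu(t)$ be a solution on $[0,\infty)$ of the viscous dyadic model $$\frac{d}{dt} a_j - 2^{c(j-1)} a_{j-1}^2 + 2^{cj} a_j a_{j+1} + \nu 2^{2j} a_j = f_j,\qquad j=0,1,2,\dots,\qquad a_{-1}=0,$$ with $a^\nu(0)\in l^2$ and $a^\nu_j(0)\ge0$ for all $j\ge 0$. Then the limit $$\lim_{T\to\infty}\frac1T\int_0^T\nu\|a^\nu(t)\|_{H^1}^2\,dt$$ exists for each $\nu>0$, and it converges to $\epsilon_{\mathrm d}>0$ as $\nu\to0$, where $\epsilon_{\mathrm d}$ is the average anomalous dissipation rate of the inviscid model ($\nu=0$) with the same $c$ and $f$.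
   Context: Sequences are real and indexed by $j=0,1,2,\dots$. Notation: $|a|^2=\sum_{j\ge0}a_j^2$, $(a,f)=\sum_{j\ge0}a_jf_j$, $\|a\|_{H^1}^2=\sum_{j\ge0}2^{2j}a_j^2$. A solution of the model with viscosity $\nu\ge0$ on $[0,\infty)$ is an $l^2$-valued function $a(t)$ defined for $t\in[0,\infty)$ such that $a_j\in C^1([0,\infty))$ and $a_j(t)$ satisfies the $j$-th equation for every $j\ge0$. Definition of $\epsilon_{\mathrm d}$: for a solution $a^0(t)$ on $[0,\infty)$ of the inviscid model (the same system with $\nu=0$) with $a^0(0)\in l^2$ and $a^0_j(0)\ge0$ for all $j$, define the anomalous energy dissipation rate, in the sense of distributions, by $$\epsilon_{a^0}(t):=(a^0(t),f)-\frac12\frac{d}{dt}|a^0(t)|^2 .$$ By the energy inequality $\epsilon_{a^0}\ge0$, so $\epsilon_{a^0}$ is a Borel measure. Then $$\epsilon_{\mathrm d}:=\lim_{T\to\infty}\frac1T\int_0^T d\epsilon_{a^0}(t);$$ it is a previously known theorem that this limit exists and is positive. *)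

(* Defs.v *)
From HB Require Import structures.
From mathcomp Require Import all_boot all_order all_algebra.
From mathcomp Require Import all_classical all_reals all_analysis.

Set Implicit Arguments.
Unset Strict Implicit.
Unset Printing Implicit Defensive.

Import Order.TTheory GRing.Theory Num.Theory.
Import numFieldNormedType.Exports.

Local Open Scope classical_set_scope.
Local Open Scope ring_scope.

Definition l2 (R : realType) (u : nat -> R) : Prop :=
  cvgn (series (fun j => u j ^+ 2)).

Definition l2_sqnorm (R : realType) (u : nat -> R) : R :=
  limn (series (fun j => u j ^+ 2)).

Definition l2_pairing (R : realType) (u v : nat -> R) : R :=
  limn (series (fun j => u j * v j)).

(* Extended-real valued, since an element of l^2 need not lie in H^1. *)
Definition H1_sqnorm (R : realType) (u : nat -> R) : \bar R :=
  (\sum_(0 <= j <oo) (2 ^+ (2 * j) * u j ^+ 2)%:E)%E.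

(* Derivative relative to [0, +oo[: two-sided for t > 0, one-sided at t = 0. *)
Definition is_derive_nneg (R : realType) (u : R -> R) (t l : R) : Prop :=
  (u s - u t) / (s - t) @[s --> within `[0, +oo[ t^'] --> l.

Definition inflow (R : realType) (c : R) (u : nat -> R) (j : nat) : R :=
  if j is i.+1 then 2 `^ (c * i%:R) * u i ^+ 2 else 0.

(* [a t j] is the j-th component at time t; only times t >= 0 matter.
   [da] is the family of the derivatives of the components. *)
Definition dyadic_solution (R : realType) (c nu : R) (f : nat -> R)
    (a : R -> nat -> R) : Prop :=
  (forall t : R, 0 <= t -> l2 (a t)) /\
  exists da : R -> nat -> R,
    [/\ forall (j : nat) (t : R), 0 <= t -> is_derive_nneg (fun s => a s j) t (da t j),
        forall j, {within `[0, +oo[, continuous (fun t => da t j)}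
      & forall (j : nat) (t : R), 0 <= t ->
          da t j - inflow c (a t) j + 2 `^ (c * j%:R) * a t j * a t j.+1
            + nu * 2 ^+ (2 * j) * a t j = f j].

(* The requirement a(0) \in l^2 is part of [dyadic_solution]. *)
Definition nneg_dyadic_solution (R : realType) (c nu : R) (f : nat -> R)
    (a : R -> nat -> R) : Prop :=
  dyadic_solution c nu f a /\ (forall j, 0 <= a 0 j).

Definition force0 (R : realType) (f0 : R) (j : nat) : R :=
  if j == 0%N then f0 else 0.

Definition test_function (R : realType) (phi : R -> R) : Prop :=
  (forall (n : nat) (x : R), derivable (derive1n n phi) x 1) /\
  exists x y : R, 0 < x /\ forall t : R, t \notin `[x, y] -> phi t = 0.

(* The measure mu, on ]0, +oo[, represents the distribution
   (a, f) - 1/2 d/dt |a|^2 on ]0, +oo[.  The values of mu outside ]0, +oo[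
   are irrelevant. *)
Definition anomalous_dissipation (R : realType) (f : nat -> R)
    (a : R -> nat -> R)
    (mu : {measure set (measurableTypeR R) -> \bar R}) : Prop :=
  forall phi : R -> R, test_function phi ->
    (\int[mu]_(t in `]0%R, +oo[) (phi t)%:E =
     \int[lebesgue_measure]_(t in `]0%R, +oo[)
       (phi t * l2_pairing (a t) f
        + 2^-1 * (derive1 phi t * l2_sqnorm (a t)))%:E)%E.

(* The distribution determines mu uniquely on ]0, +oo[, so the limit does not
   depend on the choice of mu.  The model is required to have a solution, so
   that at most one number is its average dissipation rate. *)
Definition average_anomalous_dissipation (R : realType) (c : R)
    (f : nat -> R) (eps : R) : Prop :=
  (exists a, nneg_dyadic_solution c 0 f a) /\
  forall a, nneg_dyadic_solution c 0 f a ->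
    exists mu : {measure set (measurableTypeR R) -> \bar R},
      anomalous_dissipation f a mu /\
      ((T^-1)%:E * mu `]0%R, T]%classic @[T --> +oo%R] --> eps%:E)%E.

Definition average_viscous_dissipation (R : realType) (nu : R)
    (a : R -> nat -> R) (eps : R) : Prop :=
  ((T^-1)%:E * \int[lebesgue_measure]_(t in `[0%R, T])
     (nu%:E * H1_sqnorm (a t)) @[T --> +oo%R] --> eps%:E)%E.

(* Main.v *)
Require Import Defs.
From HB Require Import structures.
From mathcomp Require Import all_boot all_order all_algebra.
From mathcomp Require Import all_classical all_reals all_analysis.
From mathcomp Require Import ring lra measurable_realfun.

Import Order.TTheory GRing.Theory Num.Theory.
Import numFieldNormedType.Exports.

Local Open Scope classical_set_scope.
Local Open Scope ring_scope.

(** Write [r = 2 `^ (c / 3)]. The inviscid model has the stationary solution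
    [A / r ^+ j] with [A ^+ 2 = f0 * r] ([fixpt]). It does not satisfy the energy
    equality: it dissipates the whole power [f0 * A] of the force, and this is
    the value of the average dissipation rate.

    Everything rests on comparing trajectories in a norm with the weights
    [2^-j]. For the difference [b] of two states [x] and [y], the cross terms
    [b_j b_{j+1} (x_j + y_j)] coming from two consecutive equations cancel
    ([comparison_identity]); what remains is a damping term, nonpositive because
    the components are nonnegative, and one cross term in the last shell. The
    latter tends to zero after integration in time, because the time integrals of
    the energy flux and of the enstrophy are bounded uniformly in the shell.
    Three comparisons are used.

    - A solution with viscosity [nu >= 0] and the fixed point
      ([fixpt_attraction]). For [3 / 2 < c] the damping controls the unweighted
      square distance, and viscosity contributes at most a multiple of [nu] per
      unit of time. If [nu = 0], the square distance is integrable over all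
      times: the first component has average [A] ([inviscid_average]) and the
      energy stays bounded ([inviscid_energy_bounded]).

    - A viscous solution and its translates in time ([viscous_contraction]):
      every component converges as time tends to infinity ([viscous_cvg]). The
      limit state satisfies the stationary power balance and has finite
      enstrophy, hence no flux at infinity: its viscous dissipation is exactly
      the power of the force ([limit_enstrophy]). The energy inequality gives
      the upper bound of the averages and convergence of the components the
      lower bound ([viscous_average]).

    - The limit state of a viscous solution and the fixed point
      ([xlim_near_fixpt]): the square of the distance of their first components
      is bounded by a multiple of [nu], so the dissipation rates converge to
      [f0 * A].

    The anomalous dissipation is the Stieltjes measure of the work of the force
    minus the kinetic energy. That function is nondecreasing as a limit of
    cumulated fluxes, and right continuous because the energy is lower
    semicontinuous ([dissipated_right_continuous]). It represents the
    distribution by an integration by parts obtained from Fubini's theorem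
    ([stieltjes_by_parts]). *)

Set Implicit Arguments.
Unset Strict Implicit.

(** * Primitives of continuous functions *)

Section Primitive.
Context {R : realType}.
Implicit Types (f g F G : R -> R) (s t : R).

Definition prim f t : R := \int[@lebesgue_measure R]_(x in `[0, t]) f x.

(** The derivative is only required at positive times, where the functions
    below are differentiable, while continuity is required on the whole line:
    this is what extending a trajectory by its initial value to negative times
    preserves. *)
Definition C1_with_deriv F f : Prop :=
  [/\ continuous F, continuous f & forall x : R, 0 < x -> is_derive x (1:R) F (f x)].

Lemma integrable_continuous f (a b : R) : continuous f ->
  (@lebesgue_measure R).-integrable `[a, b] (EFin \o f).
Proof.
move=> cf; apply: continuous_compact_integrable; first exact: segment_compact.
exact: continuous_subspaceT.
Qed.

Lemma prim0 f : prim f 0 = 0.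
Proof. by rewrite /prim set_itv1 Rintegral_set1. Qed.

Lemma integral_C1 F f s t : C1_with_deriv F f -> 0 <= s <= t ->
  (\int[@lebesgue_measure R]_(x in `[s, t]) (f x)%:E = (F t - F s)%:E)%E.
Proof.
move=> [cF cf dF] /andP[s0]; rewrite le_eqVlt => /predU1P[<-|st].
  by rewrite set_itv1 integral_set1 subrr.
rewrite EFinB; apply: continuous_FTC2 => //.
- exact: continuous_subspaceT.
- split.
  + move=> x; rewrite in_itv/= => /andP[sx _].
    by have [] := dF _ (le_lt_trans s0 sx).
  + by apply: cvg_at_right_filter; exact: cF.
  + by apply: cvg_at_left_filter; exact: cF.
- move=> x; rewrite in_itv/= => /andP[sx _].
  by rewrite derive1E; have [] := dF _ (le_lt_trans s0 sx).
Qed.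

Lemma primE F f t : C1_with_deriv F f -> 0 <= t -> prim f t = F t - F 0.
Proof. by move=> cF t0; rewrite /prim /Rintegral (integral_C1 cF) ?lexx. Qed.

Lemma le_prim f g t : continuous f -> continuous g ->
  (forall x, 0 <= x <= t -> f x <= g x) -> prim f t <= prim g t.
Proof.
move=> cf cg fg; apply: le_Rintegral => //; try exact: integrable_continuous.
Qed.

Lemma primD f g t : continuous f -> continuous g ->
  prim (fun x => f x + g x) t = prim f t + prim g t.
Proof. by move=> cf cg; apply: RintegralD => //; exact: integrable_continuous. Qed.

Lemma primB f g t : continuous f -> continuous g ->
  prim (fun x => f x - g x) t = prim f t - prim g t.
Proof. by move=> cf cg; apply: RintegralB => //; exact: integrable_continuous. Qed.

Lemma primZ f k t : continuous f -> prim (fun x => k * f x) t = k * prim f t.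
Proof. by move=> cf; apply: RintegralZl => //; exact: integrable_continuous. Qed.

Lemma prim_cst k t : 0 <= t -> prim (fun=> k) t = k * t.
Proof.
move=> t0; rewrite /prim Rintegral_cst //= lebesgue_measure_itv /= lte_fin.
by case: ltrP => [_|]; rewrite ?oppr0 ?addr0 //= => t0'; congr (_ * _); apply/le_anti/andP.
Qed.

Lemma prim_ge0 f t : (forall x, 0 <= x <= t -> 0 <= f x) -> 0 <= prim f t.
Proof. by move=> f0; apply: Rintegral_ge0 => x /=; rewrite in_itv/=; exact: f0. Qed.

Lemma cont_cst (k : R) : continuous (fun _ : R => k).
Proof. by move=> x; exact: cvg_cst. Qed.

Lemma cont_id : continuous (fun x : R => x).
Proof. by move=> x; exact: cvg_id. Qed.

Lemma cont_add f g : continuous f -> continuous g -> continuous (fun x => f x + g x).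
Proof. by move=> cf cg x; apply: cvgD; [exact: cf|exact: cg]. Qed.

Lemma cont_opp f : continuous f -> continuous (fun x => - f x).
Proof. by move=> cf x; apply: cvgN; exact: cf. Qed.

Lemma cont_mul f g : continuous f -> continuous g -> continuous (fun x => f x * g x).
Proof. by move=> cf cg x; apply: cvgM; [exact: cf|exact: cg]. Qed.

Lemma cont_exp f n : continuous f -> continuous (fun x => f x ^+ n).
Proof.
move=> cf; elim: n => [|n ih]; first exact: cont_cst.
rewrite (_ : (fun x => _) = (fun x => f x * f x ^+ n)); first exact: cont_mul.
by apply/funext => x; rewrite exprS.
Qed.

Lemma cont_sum n (h : nat -> R -> R) : (forall j, continuous (h j)) ->
  continuous (fun x => \sum_(j < n) h j x).
Proof.
move=> ch; elim: n => [|n ih].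
  rewrite (_ : (fun x => _) = (fun=> 0)); first exact: cont_cst.
  by apply/funext => x; rewrite big_ord0.
rewrite (_ : (fun x => _) = (fun x => \sum_(j < n) h j x + h n x)).
  exact: cont_add.
by apply/funext => x; rewrite big_ord_recr.
Qed.

Lemma prim_sum n (h : nat -> R -> R) t : (forall j, continuous (h j)) -> 0 <= t ->
  prim (fun x => \sum_(j < n) h j x) t = \sum_(j < n) prim (h j) t.
Proof.
move=> ch t0; elim: n => [|n ih].
  rewrite big_ord0 (_ : (fun x => _) = (fun=> 0)) ?prim_cst ?mul0r//.
  by apply/funext => x; rewrite big_ord0.
rewrite big_ord_recr /= -ih -primD //; last exact: cont_sum.
by congr prim; apply/funext => x; rewrite big_ord_recr.
Qed.

Lemma C1_eq F f g : C1_with_deriv F f -> f =1 g -> C1_with_deriv F g.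
Proof. by move=> cF /funext <-. Qed.

Lemma C1_cst (k : R) : C1_with_deriv (fun=> k) (fun=> 0).
Proof.
split; [exact: cont_cst | exact: cont_cst | move=> x _].
exact: is_derive_cst.
Qed.

Lemma C1_id : C1_with_deriv (fun x => x) (fun=> 1).
Proof.
split; [exact: cont_id | exact: cont_cst | move=> x _].
exact: is_derive_id.
Qed.

Lemma C1_add F f G g : C1_with_deriv F f -> C1_with_deriv G g ->
  C1_with_deriv (fun x => F x + G x) (fun x => f x + g x).
Proof.
move=> [cF cf dF] [cG cg dG]; split; [exact: cont_add | exact: cont_add |].
by move=> x x0; apply: is_deriveD; [exact: dF|exact: dG].
Qed.

Lemma C1_mul F f G g : C1_with_deriv F f -> C1_with_deriv G g ->
  C1_with_deriv (fun x => F x * G x) (fun x => F x * g x + G x * f x).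
Proof.
move=> [cF cf dF] [cG cg dG]; split; first exact: cont_mul.
  by apply: cont_add; exact: cont_mul.
by move=> x x0; apply: (is_deriveM (dF _ x0) (dG _ x0)).
Qed.

Lemma C1_scale (k : R) F f : C1_with_deriv F f ->
  C1_with_deriv (fun x => k * F x) (fun x => k * f x).
Proof.
move=> cF; apply: C1_eq (C1_mul (C1_cst k) cF) _ => x.
by rewrite mulr0 addr0.
Qed.

Lemma C1_opp F f : C1_with_deriv F f ->
  C1_with_deriv (fun x => - F x) (fun x => - f x).
Proof.
move=> [cF cf dF]; split; [exact: cont_opp | exact: cont_opp |].
by move=> x x0; apply: is_deriveN; exact: dF.
Qed.

Lemma C1_sum n (H h : nat -> R -> R) : (forall j, C1_with_deriv (H j) (h j)) ->
  C1_with_deriv (fun x => \sum_(j < n) H j x) (fun x => \sum_(j < n) h j x).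
Proof.
move=> ch; elim: n => [|n ih].
  rewrite (_ : (fun x => _) = (fun=> 0)); last first.
    by apply/funext => x; rewrite big_ord0.
  by apply: C1_eq (C1_cst 0) _ => x; rewrite big_ord0.
rewrite (_ : (fun x => _) = (fun x => \sum_(j < n) H j x + H n x)).
  by apply: C1_eq (C1_add ih (ch n)) _ => x; rewrite big_ord_recr.
by apply/funext => x; rewrite big_ord_recr.
Qed.

Lemma le_primB f g s t : continuous f -> continuous g -> 0 <= s <= t ->
  (forall x, s <= x <= t -> f x <= g x) ->
  prim f t - prim f s <= prim g t - prim g s.
Proof.
move=> cf cg /andP[s0 st] fg.
have iB h : continuous h ->
    prim h t - prim h s = \int[@lebesgue_measure R]_(x in `]s, t]) h x.
  move=> ch; apply: Rintegral_itvB; first exact: integrable_continuous.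
    by rewrite bnd_simp.
  by rewrite bnd_simp.
rewrite !iB //; apply: le_Rintegral => //.
- by apply: integrableS (integrable_continuous s t cf) => //; apply: subset_itv_oc_cc.
- by apply: integrableS (integrable_continuous s t cg) => //; apply: subset_itv_oc_cc.
- by move=> x /=; rewrite in_itv /= => /andP[/ltW sx xt]; rewrite fg // sx.
Qed.

Lemma prim_mono f s t : continuous f -> (forall x, 0 <= f x) -> 0 <= s <= t ->
  prim f s <= prim f t.
Proof.
move=> cf f0 st; rewrite -subr_ge0.
have /andP[s0 le_st] := st.
have := @le_primB (fun=> 0) f s t (cont_cst (k := 0)) cf st (fun x _ => f0 x).
by rewrite !prim_cst ?(le_trans s0 le_st) // !mul0r subrr.
Qed.

Lemma C1_sq F f : C1_with_deriv F f ->
  C1_with_deriv (fun x => F x ^+ 2) (fun x => 2 * (F x * f x)).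
Proof.
by move=> cF; apply: C1_eq (C1_mul cF cF) _ => x; rewrite mulr_natl mulr2n.
Qed.

(** How the truncation order is removed from an estimate. *)
Lemma le_of_cvg0 (u v : R) (e : nat -> R) :
  (\forall n \near \oo, u <= v + e n) -> e n @[n --> \oo] --> 0 -> u <= v.
Proof.
move=> h e0; have c : (fun n => v + e n) n @[n --> \oo] --> v.
  by rewrite -[X in _ --> X]addr0; apply: cvgD => //; exact: cvg_cst.
by rewrite -(cvg_lim _ c) //; apply: limr_ge => //; apply/cvg_ex; exists v.
Qed.

Lemma cvg_geom0 (q k : R) : 0 <= q < 1 -> k * q ^+ n @[n --> \oo] --> 0.
Proof.
move=> /andP[q0 q1]; rewrite -[X in _ --> X](mulr0 k).
by apply: cvgM; [exact: cvg_cst | apply: cvg_expr; rewrite ger0_norm].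
Qed.

Lemma cvg_invy0 : t^-1 @[t --> +oo] --> (0 : R).
Proof.
apply/gtr0_cvgV0; last exact: cvg_id.
exact: nbhs_pinfty_gt.
Qed.

End Primitive.

(** Reduces continuity of an arithmetic expression to that of its atoms; the
    matching is syntactic because unification would unfold defined functions. *)
Ltac cont_tac :=
  lazymatch goal with
  | |- forall x, continuous_at x (fun _ => ?k) => exact: cont_cst
  | |- forall x, continuous_at x (fun t => t) => exact: cont_id
  | |- forall x, continuous_at x (fun t => @?f t + @?g t) =>
      apply: (@cont_add _ f g); cont_tac
  | |- forall x, continuous_at x (fun t => - @?f t) =>
      apply: (@cont_opp _ f); cont_tac
  | |- forall x, continuous_at x (fun t => @?f t * @?g t) =>
      apply: (@cont_mul _ f g); cont_tac
  | |- forall x, continuous_at x (fun t => @?f t ^+ ?n) =>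
      apply: (@cont_exp _ f n); cont_tac
  | |- _ => idtac
  end.

(** * Extension from the half-line and integrating factors *)

Section Extension.
Context {R : realType}.
Implicit Types (f g u F G : R -> R) (s t : R).

Lemma max0_cvg t :
  Num.max 0 s @[s --> t] --> within `[0, +oo[ (nbhs (Num.max 0 t)).
Proof.
have c0 : Num.max 0 s @[s --> t] --> Num.max 0 t.
  apply/cvgrPdist_lt => e e0; near=> s.
  apply: (@le_lt_trans _ _ `|t - s|); last first.
    by near: s; apply: cvgr_dist_lt => //; exact: cvg_id.
  rewrite ler_norml; case: (lerP 0 t) => t0; case: (lerP 0 s) => s0;
    rewrite ?subr0 ?sub0r; apply/andP; split;
    have := ler_norm (t - s); have := ler_norm (- (t - s)); rewrite normrN; lra.
move=> A; rewrite /within /= => /c0; rewrite !nbhs_simpl /=.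
apply: filterS => s; apply.
by rewrite /= in_itv /= andbT le_max lexx.
Unshelve. all: by end_near. Qed.

(** Composing with the retraction [max 0] of the line onto the half-line makes
    one-sided continuity at the origin an instance of plain continuity. *)
Lemma cont_comp_max0 f :
  (forall t, 0 <= t -> f s @[s --> within `[0, +oo[ (nbhs t)] --> f t) ->
  continuous (fun t => f (Num.max 0 t)).
Proof.
move=> cf t; apply: (@cvg_comp _ _ _ (Num.max 0) f _ _ _ (max0_cvg (t:=t))); apply: cf.
by rewrite le_max lexx.
Qed.

(** With the quotient completed on the diagonal, as in Caratheodory's definition
    of the derivative, continuity and differentiability of [u] both follow from
    the limit of [slope]. *)
Let slope u t l s := if s == t then l else (u s - u t) / (s - t).

Let slope_cvg u t l : is_derive_nneg u t l ->
  slope u t l s @[s --> within `[0, +oo[ (nbhs t)] --> l.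
Proof.
move=> du; apply/cvgrPdist_lt => e e0.
move/cvgrPdist_lt : du => /(_ e e0); rewrite /dnbhs !near_withinE.
apply: filterS => s H Ds; rewrite /slope; case: eqP => [_|/eqP st].
  by rewrite subrr normr0.
exact: H.
Qed.

Let slopeE u t l s : u s - u t = slope u t l s * (s - t).
Proof.
rewrite /slope; case: eqVneq => [->|st]; first by rewrite !subrr mulr0.
by rewrite divfK // subr_eq0.
Qed.

Lemma is_derive_nneg_cvg u t l : is_derive_nneg u t l ->
  u s @[s --> within `[0, +oo[ (nbhs t)] --> u t.
Proof.
move=> du; rewrite (_ : u = (fun s => u t + slope u t l s * (s - t))); last first.
  by apply/funext => s; rewrite -slopeE addrC subrK.
rewrite /= subrr mulr0 addr0 -[X in _ --> X]addr0.
apply: cvgD; first exact: cvg_cst.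
rewrite -[X in _ --> X](mulr0 l); apply: cvgM; first exact: slope_cvg.
rewrite -[X in _ --> X](subrr t); apply: cvgB; last exact: cvg_cst.
by apply: cvg_within_filter; exact: cvg_id.
Qed.

Lemma is_derive_nneg_pos u t l : 0 < t -> is_derive_nneg u t l ->
  is_derive t (1:R) (fun s => u (Num.max 0 s)) l.
Proof.
move=> t0 du; apply/is_derive1_caratheodory.
have mt : Num.max 0 t = t by apply/max_idPr/ltW.
exists (slope (fun s => u (Num.max 0 s)) t l); split; last by rewrite /slope eqxx.
  by move=> z; exact: slopeE.
rewrite /prop_for /continuous_at {2}/slope eqxx.
have /cvgrPdist_lt h := slope_cvg du.
apply/cvgrPdist_lt => e e0; have := h e e0.
rewrite near_withinE => h'; near=> s.
have s0 : 0 < s by near: s; exact: lt_nbhsr.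
have ms : Num.max 0 s = s by apply/max_idPr/ltW.
rewrite /slope mt ms -/(slope u t l s).
have : s \in `[0, +oo[ by rewrite in_itv /= (ltW s0).
by near: s.
Unshelve. all: by end_near. Qed.

Lemma prim_max0 f t : prim f (Num.max 0 t) = prim f t.
Proof.
case: (lerP 0 t) => // t0; rewrite prim0.
by rewrite /prim set_itv_ge ?Rintegral_set0 // bnd_simp -ltNge.
Qed.

Lemma C1_prim f : continuous f -> C1_with_deriv (prim f) f.
Proof.
move=> cf; split => //.
  rewrite (_ : prim f = fun t => prim f (Num.max 0 t)); last first.
    by apply/funext => t; rewrite prim_max0.
  apply: cont_comp_max0 => t t0.
  have t1 : 0 < t + 1 by rewrite ltr_wpDl.
  have /subspace_continuousP := parameterized_integral_continuous
    (ltW t1) (integrable_continuous 0 (t + 1) cf).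
  move=> /(_ t); rewrite /= in_itv /= t0 lerDl ler01 => /(_ isT) h.
  move=> A /h hA; change (\forall s \near nbhs t, s \in `[0, +oo[ -> A (prim f s)).
  have {}hA : \forall s \near nbhs t, s \in `[0, t + 1] -> A (prim f s) := hA.
  have lt1 : \forall s \near t, s < t + 1 by apply: lt_nbhsl; rewrite ltrDl.
  apply: filterS2 hA lt1 => s hA st.
  rewrite in_itv /= andbT => s0; apply: hA.
  by rewrite in_itv /= s0 ltW.
move=> t t0.
have tu : t < t + 1 by rewrite ltrDl.
have [df f'] := continuous_FTC1_closed tu
  (integrable_continuous 0 (t + 1) cf) t0 (cf t).
by apply: DeriveDef => //; rewrite -derive1E.
Qed.

Lemma integral_prim (h : R -> R) T : continuous h -> 0 <= T ->
  (\int[@lebesgue_measure R]_(t in `[0%R, T]) (h t)%:E = (prim h T)%:E)%E.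
Proof.
by move=> ch T0; rewrite (integral_C1 (C1_prim ch)) ?lexx // prim0 subr0.
Qed.

(** A linear differential inequality preserves nonnegativity, whatever the sign
    of its coefficient, by means of the integrating factor. *)
Lemma linear_ineq_ge0 (z dz q : R -> R) : C1_with_deriv z dz -> continuous q ->
  0 <= z 0 -> (forall t, 0 <= t -> - q t * z t <= dz t) ->
  forall t, 0 <= t -> 0 <= z t.
Proof.
move=> cz cq z0 zq t t0.
have [cP _ dP] := C1_prim cq.
have cE : C1_with_deriv (fun x => expR (prim q x)) (fun x => q x * expR (prim q x)).
  have ce : continuous (fun x => expR (prim q x)).
    by move=> x; apply: continuous_comp; [exact: cP | exact: continuous_expR].
  split => //; first exact: cont_mul.
  move=> x x0; rewrite mulrC.
  exact: (is_derive1_comp (is_derive_expR _) (dP _ x0)).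
have cF := C1_mul cz cE.
have [_ cf _] := cF.
have := primE cF t0.
have : 0 <= prim (fun x : R => z x * (q x * expR (prim q x)) + expR (prim q x) * dz x) t.
  apply: prim_ge0 => x /andP[x0 _].
  rewrite (_ : _ + _ = expR (prim q x) * (dz x - - q x * z x)); last by ring.
  by rewrite mulr_ge0 ?expR_ge0// subr_ge0 zq.
move=> + e; rewrite e prim0 expR0 mulr1 subr_ge0 => h.
by rewrite -(pmulr_lge0 _ (expR_gt0 (prim q t))) (le_trans z0 h).
Qed.

End Extension.

(** * Time averages *)

Section Averages.
Context {R : realType}.
Implicit Types f : R -> R.

(** By the inequality of arithmetic and geometric means, deviations whose
    square has a bounded integral have a negligible average. *)
Lemma average_of_sq f (l C : R) : continuous f ->
  (forall T, 0 <= T -> prim (fun t => (f t - l) ^+ 2) T <= C) ->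
  T^-1 * prim f T @[T --> +oo] --> l.
Proof.
move=> cf fC; apply/cvgrPdist_le => e e0.
pose d := e / 2; have d0 : 0 < d by rewrite divr_gt0.
have C0 : 0 <= C by have := fC 0 (lexx _); rewrite prim0.
near=> T.
have T0 : 0 < T by near: T; exact: nbhs_pinfty_gt.
have TC : C / d / (e / 2) <= T by near: T; apply: nbhs_pinfty_ge; rewrite num_real.
have cd : continuous (fun t => (f t - l) ^+ 2) by cont_tac.
have split_le (s : R) : s <= d + s ^+ 2 / d.
  have -> : d + s ^+ 2 / d = (d ^+ 2 + s ^+ 2) / d by field; rewrite gt_eqF.
  rewrite ler_pdivlMr //.
  have := sqr_ge0 (s - d); have := sqr_ge0 s; have := sqr_ge0 d; nra.
have bnd : d * T + C / d <= e * T.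
  have : C / d <= e / 2 * T by rewrite [leRHS]mulrC -ler_pdivrMr // divr_gt0.
  by rewrite /d; lra.
have dT : d^-1 * prim (fun t => (f t - l) ^+ 2) T <= C / d.
  by rewrite mulrC ler_pdivlMr // divfK ?gt_eqF // fC // ltW.
have prim_le : prim (fun t => d + d^-1 * (f t - l) ^+ 2) T <= e * T.
  rewrite primD; [|exact: cont_cst|by cont_tac].
  rewrite prim_cst ?(ltW T0) // primZ //; apply: le_trans bnd; lra.
have up : prim f T - l * T <= e * T.
  rewrite -(prim_cst l (ltW T0)) -primB //; last exact: cont_cst.
  apply: le_trans prim_le; apply: le_prim => [||t _]; [by cont_tac|by cont_tac|].
  by have := split_le (f t - l); rewrite mulrC.
have lo : l * T - prim f T <= e * T.
  rewrite -(prim_cst l (ltW T0)) -primB //; last exact: cont_cst.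
  apply: le_trans prim_le; apply: le_prim => [||t _]; [by cont_tac|by cont_tac|].
  by have := split_le (l - f t); rewrite mulrC -(sqrrN (l - f t)) opprB.
have -> : l - T^-1 * prim f T = T^-1 * (l * T - prim f T) by field; rewrite gt_eqF.
rewrite normrM gtr0_norm ?invr_gt0 // mulrC ler_pdivrMr // ler_norml.
by apply/andP; split; lra.
Unshelve. all: by end_near. Qed.

Lemma average_of_limit f (l : R) : continuous f -> f t @[t --> +oo] --> l ->
  T^-1 * prim f T @[T --> +oo] --> l.
Proof.
move=> cf fl; apply/cvgrPdist_le => e e0.
have e2 : 0 < e / 2 by rewrite divr_gt0.
have [N [_ HN]] : \forall t \near +oo, `|l - f t| <= e / 2.
  by move/cvgrPdist_le : fl; apply.
pose M := Num.max N 0 + 1.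
have NM : N < M by rewrite (le_lt_trans (y := Num.max N 0)) ?le_max ?lexx // ltrDl.
have M0 : 0 <= M by rewrite addr_ge0 // le_max lexx orbT.
pose C := `|prim f M - l * M|.
near=> T.
have T0 : 0 < T by near: T; exact: nbhs_pinfty_gt.
have MT : M <= T by near: T; apply: nbhs_pinfty_ge; rewrite num_real.
have TC : C / (e / 2) <= T by near: T; apply: nbhs_pinfty_ge; rewrite num_real.
have {}TC : C <= e / 2 * T by rewrite [leRHS]mulrC -ler_pdivrMr.
have dev s : M <= s <= T -> l - e / 2 <= f s <= l + e / 2.
  move=> /andP[Ms _]; have := HN s (lt_le_trans NM Ms); rewrite ler_norml.
  by move=> /andP[a b]; apply/andP; split; lra.
have MT' : 0 <= M <= T by rewrite M0.
have up := le_primB cf (cont_cst (k := l + e / 2)) MT' (fun s h => proj2 (andP (dev s h))).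
have lo := le_primB (cont_cst (k := l - e / 2)) cf MT' (fun s h => proj1 (andP (dev s h))).
rewrite !prim_cst ?(ltW T0) // in up lo.
have : `|prim f M - l * M| <= C by [].
rewrite ler_norml => /andP[c1 c2].
have eM : 0 <= e / 2 * M by rewrite mulr_ge0 // ltW.
have -> : l - T^-1 * prim f T = T^-1 * (l * T - prim f T) by field; rewrite gt_eqF.
rewrite normrM gtr0_norm ?invr_gt0 // mulrC ler_pdivrMr // ler_norml.
by apply/andP; split; nra.
Unshelve. all: by end_near. Qed.

End Averages.

(** * Algebra of the dyadic model *)

Section Model.
Context {R : realType}.
Implicit Types (r nu : R) (x y : nat -> R).

(** The nonlinear part of the [j]-th equation. With [r = 2 `^ (c / 3)] the
    coefficients [2 `^ (c * j)] are the natural powers [r ^+ (3 * j)], and the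
    inviscid fixed point is a geometric sequence of ratio [r^-1]. *)
Definition transport r x (j : nat) : R :=
  (if j is i.+1 then r ^+ (3 * i) * x i ^+ 2 else 0)
    - r ^+ (3 * j) * x j * x j.+1.

Definition dyadic_rhs r nu (f0 : R) x (j : nat) : R :=
  force0 f0 j + transport r x j - nu * 2 ^+ (2 * j) * x j.

Definition flux r x (n : nat) : R := r ^+ (3 * n) * x n ^+ 2 * x n.+1.

(** The nonlinear terms telescope: the shells up to [n] lose energy only through
    the flux to shell [n.+1] and through viscosity. *)
Lemma energy_identity r nu (f0 : R) x n :
  \sum_(j < n.+1) 2 * (x j * dyadic_rhs r nu f0 x j) =
  2 * (f0 * x 0%N - flux r x n - nu * \sum_(j < n.+1) 2 ^+ (2 * j) * x j ^+ 2).
Proof.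
elim: n => [|n ih].
  by rewrite !big_ord1 /dyadic_rhs /transport /flux /force0 /=; ring.
rewrite big_ord_recr ih [in RHS]big_ord_recr /=.
rewrite /dyadic_rhs /transport /flux /force0 /=; ring.
Qed.

(** With the weights [2^-j] the cross terms [b_j b_{j+1} (x_j + y_j)] of two
    consecutive equations cancel; only the last one survives. *)
Lemma comparison_identity r x y n :
  \sum_(j < n.+1) 2^-1 ^+ j * (2 * (x j - y j) * (transport r x j - transport r y j)) =
  - (\sum_(j < n) 2^-1 ^+ j * r ^+ (3 * j) * (x j.+1 + y j.+1) * (x j - y j) ^+ 2)
  - 2 * 2^-1 ^+ n * r ^+ (3 * n) * (x n - y n) * (x n * x n.+1 - y n * y n.+1).
Proof.
elim: n => [|n ih].
  by rewrite !big_ord1 big_ord0 /transport /=; ring.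
rewrite big_ord_recr ih [in RHS]big_ord_recr /= /transport exprS.
by field.
Qed.

(** What the estimates use of a trajectory extended to negative times by its
    initial value. *)
Record regular_solution r nu (f0 : R) (x : nat -> R -> R) : Prop := RegularSolution {
  rs_C1 : forall j, C1_with_deriv (x j) (fun t => dyadic_rhs r nu f0 (x^~ t) j);
  rs_ge0 : forall j t, 0 <= x j t;
  rs_l2 : exists B, forall n, \sum_(j < n) x j 0 ^+ 2 <= B }.

Lemma cont_transport r (x : nat -> R -> R) j : (forall i, continuous (x i)) ->
  continuous (fun t => transport r (x^~ t) j).
Proof.
move=> cx; rewrite /transport; case: j => [|j]; cont_tac; exact: cx.
Qed.

Lemma cont_rhs r nu (f0 : R) (x : nat -> R -> R) j : (forall i, continuous (x i)) ->
  continuous (fun t => dyadic_rhs r nu f0 (x^~ t) j).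
Proof.
move=> cx; rewrite /dyadic_rhs; apply: cont_add; last by cont_tac; exact: cx.
by apply: cont_add; [exact: cont_cst | exact: cont_transport].
Qed.

Lemma powR2_exp (c : R) j : 2 `^ (c * j%:R) = (2 `^ (c / 3)) ^+ (3 * j) :> R.
Proof.
rewrite -powR_mulrn ?powR_ge0// -powRrM natrM; congr (_ `^ _).
by field.
Qed.

Lemma l2_partial_le (u : nat -> R) n : l2 u -> \sum_(j < n) u j ^+ 2 <= l2_sqnorm u.
Proof.
move=> lu; rewrite -(big_mkord xpredT (fun j => u j ^+ 2)).
apply: (@nondecreasing_cvgn_le _ (series (fun j => u j ^+ 2))) => //.
apply/nondecreasing_seqP => k; rewrite /series /= big_nat_recr //=.
by rewrite lerDl sqr_ge0.
Qed.

(** Nonnegativity propagates because the [j]-th equation is a linear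
    inequality for the [j]-th component, the inflow being a square. *)
Lemma regularize (c nu f0 : R) (a : R -> nat -> R) : 0 <= f0 ->
  nneg_dyadic_solution c nu (force0 f0) a ->
  regular_solution (2 `^ (c / 3)) nu f0 (fun j t => a (Num.max 0 t) j).
Proof.
move=> f00 [[al2 [da [dada _ aeq]]] a0].
set r := 2 `^ (c / 3).
have r0 : 0 <= r by exact: powR_ge0.
have cx j : continuous (fun t : R => a (Num.max 0 t) j).
  apply: (@cont_comp_max0 _ (fun t => a t j)) => t t0.
  exact: (is_derive_nneg_cvg (dada j t t0)).
have C1x j : C1_with_deriv (fun t : R => a (Num.max 0 t) j)
    (fun t : R => dyadic_rhs r nu f0 (fun i => a (Num.max 0 t) i) j).
  split; [exact: cx | exact: (@cont_rhs r nu f0 (fun j (t : R) => a (Num.max 0 t) j)) |].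
  move=> t t0; have := is_derive_nneg_pos t0 (dada j t (ltW t0)).
  rewrite (max_idPr (ltW t0)) (_ : da t j = dyadic_rhs r nu f0 (a t) j) //.
  have := aeq j t (ltW t0); rewrite /dyadic_rhs /transport /inflow powR2_exp -/r.
  by case: j => [|j]; rewrite ?powR2_exp -/r; lra.
split => //.
- have pos j (t : R) : 0 <= t -> 0 <= a (Num.max 0 t) j.
    apply: (linear_ineq_ge0 (C1x j)
        (q := fun t : R => r ^+ (3 * j) * a (Num.max 0 t) j.+1 + nu * 2 ^+ (2 * j))).
    + by cont_tac; exact: cx.
    + by rewrite maxxx.
    + move=> s _; rewrite -subr_ge0.
      rewrite (_ : _ - _ = force0 f0 j + (if j is i.+1 then r ^+ (3 * i) * a (Num.max 0 s) i ^+ 2 else 0)).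
        rewrite addr_ge0 //; first by rewrite /force0; case: ifP.
        by case: j => [|i]; [exact: lexx | apply: mulr_ge0; [exact: exprn_ge0 | exact: sqr_ge0]].
      by rewrite /dyadic_rhs /transport; case: (j) => [|i] /=; ring.
  move=> j t; case: (lerP 0 t) => t0; last exact: a0.
  by have := pos j t t0; rewrite (max_idPr t0).
- exists (l2_sqnorm (a 0)) => n; rewrite maxxx.
  by apply: l2_partial_le; exact: al2.
Qed.

Lemma root_scale_bounds (c : R) : 3 / 2 < c -> c <= 5 / 2 ->
  let r : R := 2 `^ (c / 3) in [/\ 0 < r, 2 < r ^+ 2 & r ^+ 6 <= 32].
Proof.
move=> c1 c2 r; have r0 : 0 < r by exact: powR_gt0.
split => //.
- rewrite /r -powR_mulrn ?powR_ge0// -powRrM.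
  rewrite -[X in X < _]lnK ?posrE// /powR pnatr_eq0 /= ltr_expR.
  by rewrite ltr_pMl ?ln_gt0 ?ltr1n //; lra.
- rewrite /r -powR_mulrn ?powR_ge0// -powRrM (_ : 32 = 2 `^ 5%:R); last first.
    by rewrite powR_mulrn //; ring.
  by rewrite ler_powR ?ler1n //; lra.
Qed.

(** The two consequences of [c <= 5 / 2] in terms of the root [r] of the scale:
    they make geometric the errors left in the last shell. *)
Lemma root_scale_lt2 (r : R) : 0 < r -> r ^+ 6 <= 32 -> r < 2.
Proof.
move=> r0 r6; rewrite -(@ltr_pXn2r _ 6) ?nnegrE ?ltW //; apply: le_lt_trans r6 _.
by rewrite !exprS expr0; lra.
Qed.

Lemma cube_ratio_lt1 (r : R) : 0 < r -> r ^+ 6 <= 32 -> 0 <= r ^+ 3 / 8 < 1.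
Proof.
move=> r0 r6; rewrite divr_ge0 ?exprn_ge0 ?ltW //= ltr_pdivrMr // mul1r.
have -> : 8 = 2 ^+ 3 :> R by rewrite !exprS expr0; ring.
by rewrite ltr_pXn2r ?nnegrE ?(ltW r0) // root_scale_lt2.
Qed.

End Model.

(** * Energy estimates *)

Section Energy.
Context {R : realType}.
Variables (r nu f0 : R) (x : nat -> R -> R) (B : R).
Hypotheses (r0 : 0 < r) (nu0 : 0 <= nu) (f00 : 0 <= f0).
Hypothesis solx : regular_solution r nu f0 x.
Hypothesis xB : forall n, \sum_(j < n) x j 0 ^+ 2 <= B.

Let x0 j t : 0 <= x j t. Proof. exact: (rs_ge0 solx). Qed.

Lemma rs_cont j : continuous (x j).
Proof. by have [] := rs_C1 solx j. Qed.

Let cx := rs_cont.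

(** Initial energy plus twice the work of the force: it bounds separately the
    energy at time [t] and twice the losses up to [t] by flux and by viscosity. *)
Definition energy_budget t := B + 2 * f0 * prim (x 0%N) t.

Lemma cont_flux n : continuous (fun t => flux r (x^~ t) n).
Proof. by rewrite /flux; cont_tac; exact: cx. Qed.

Definition enstrophy n t := \sum_(j < n.+1) 2 ^+ (2 * j) * x j t ^+ 2.

Lemma cont_enstrophy n : continuous (enstrophy n).
Proof.
by apply: (@cont_sum _ _ (fun j t => 2 ^+ (2 * j) * x j t ^+ 2)) => j; cont_tac; exact: cx.
Qed.

Lemma flux_ge0 n t : 0 <= flux r (x^~ t) n.
Proof. by rewrite /flux !mulr_ge0 ?exprn_ge0 // ltW. Qed.

Lemma enstrophy_ge0 n t : 0 <= enstrophy n t.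
Proof. by apply: sumr_ge0 => j _; rewrite mulr_ge0 ?sqr_ge0 ?exprn_ge0. Qed.

Lemma energy_C1 n : C1_with_deriv (fun t => \sum_(j < n.+1) x j t ^+ 2)
  (fun t => 2 * (f0 * x 0%N t - flux r (x^~ t) n - nu * enstrophy n t)).
Proof.
apply: C1_eq (C1_sum n.+1 (fun j => C1_sq (rs_C1 solx j))) _ => t.
exact: energy_identity.
Qed.

Lemma energy_balance n t : 0 <= t ->
  \sum_(j < n.+1) x j t ^+ 2 + 2 * prim (fun s => flux r (x^~ s) n) t
    + 2 * nu * prim (enstrophy n) t =
  \sum_(j < n.+1) x j 0 ^+ 2 + 2 * f0 * prim (x 0%N) t.
Proof.
move=> t0; have := primE (energy_C1 n) t0.
have c1 := cont_flux (n := n); have c2 := cont_enstrophy (n := n).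
rewrite primZ ?primB ?primZ //;
  try by cont_tac; first [exact: cx | exact: c1 | exact: c2].
by rewrite mulrDr; lra.
Qed.

Lemma energy_budget_mono s t : 0 <= s <= t -> energy_budget s <= energy_budget t.
Proof.
move=> st; rewrite /energy_budget lerD2l; apply: ler_wpM2l; first by rewrite mulr_ge0.
by apply: prim_mono => //; exact: cx.
Qed.

Let flux_int_ge0 n t : 0 <= prim (fun s => flux r (x^~ s) n) t.
Proof. by apply: prim_ge0 => s _; exact: flux_ge0. Qed.

Let enstrophy_int_ge0 n t : 0 <= 2 * nu * prim (enstrophy n) t.
Proof.
rewrite mulr_ge0 ?mulr_ge0 //.
by apply: prim_ge0 => s _; exact: enstrophy_ge0.
Qed.

Lemma energy_le n t : 0 <= t -> \sum_(j < n) x j t ^+ 2 <= energy_budget t.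
Proof.
move=> t0; apply: (@le_trans _ _ (\sum_(j < n.+1) x j t ^+ 2)).
  by rewrite big_ord_recr /= lerDl sqr_ge0.
have := energy_balance n t0; have := flux_int_ge0 n t; have := enstrophy_int_ge0 n t.
have := xB n.+1; rewrite /energy_budget; lra.
Qed.

Lemma flux_int_le n t : 0 <= t ->
  2 * prim (fun s => flux r (x^~ s) n) t <= energy_budget t.
Proof.
move=> t0; have := energy_balance n t0; have := enstrophy_int_ge0 n t.
have : 0 <= \sum_(j < n.+1) x j t ^+ 2 by apply: sumr_ge0 => j _; exact: sqr_ge0.
have := xB n.+1; rewrite /energy_budget; lra.
Qed.

Lemma enstrophy_int_le n t : 0 <= t ->
  2 * nu * prim (enstrophy n) t <= energy_budget t.
Proof.
move=> t0; have := energy_balance n t0; have := flux_int_ge0 n t.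
have : 0 <= \sum_(j < n.+1) x j t ^+ 2 by apply: sumr_ge0 => j _; exact: sqr_ge0.
have := xB n.+1; rewrite /energy_budget; lra.
Qed.

Lemma component_le j s t : 0 <= s <= t -> x j s <= 1 + energy_budget t.
Proof.
move=> /andP[s0 st]; have := energy_le j.+1 s0; rewrite big_ord_recr /=.
have : 0 <= \sum_(i < j) x i s ^+ 2 by apply: sumr_ge0 => i _; exact: sqr_ge0.
have := @energy_budget_mono s t; rewrite s0 st => /(_ isT).
have := sqr_ge0 (x j s - 1); rewrite sqrrB1.
have := x0 j s; nra.
Qed.

End Energy.

(** * The inviscid fixed point *)

Section Stationary.
Context {R : realType}.
Variables (r A : R).
Hypotheses (r0 : 0 < r) (A0 : 0 < A) (r2 : 2 < r ^+ 2).

(** The fixed point of the inviscid model; the forcing is [A ^+ 2 / r]. *)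
Definition fixpt (j : nat) : R := A / r ^+ j.

Lemma fixpt_ge0 j : 0 <= fixpt j.
Proof. by rewrite divr_ge0 ?exprn_ge0 ?ltW. Qed.

Let rn0 n : r ^+ n != 0. Proof. by rewrite expf_neq0 // gt_eqF. Qed.

Let rr : r != 0. Proof. by rewrite gt_eqF. Qed.

Let r3 j : r ^+ (3 * j) = (r ^+ j) ^+ 3. Proof. by rewrite mulnC exprM. Qed.

Let r1 j : r ^+ j.+1 = r ^+ j * r. Proof. exact: exprSr. Qed.

Lemma fixpt_stationary j : force0 (A ^+ 2 / r) j + transport r fixpt j = 0.
Proof.
rewrite /transport /fixpt; case: j => [|j]; rewrite /force0 /=.
  by rewrite muln0 !expr0 expr1; field.
rewrite !r3 !r1; field; by rewrite rr rn0.
Qed.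

(** The sum of the series of the [2 ^+ j * fixpt j ^+ 2]; its convergence is
    the condition [3 / 2 < c]. *)
Definition fixpt_budget : R := A ^+ 2 * r ^+ 2 / (r ^+ 2 - 2).

Lemma fixpt_sum_le n : \sum_(j < n) 2 ^+ j * fixpt j ^+ 2 <= fixpt_budget.
Proof.
have q0 : 0 < r ^+ 2 - 2 by rewrite subr_gt0.
have q1 : r ^+ 2 - 2 != 0 by rewrite gt_eqF.
suff : \sum_(j < n) 2 ^+ j * fixpt j ^+ 2 = fixpt_budget * (1 - 2 ^+ n / (r ^+ n) ^+ 2).
  move=> ->; rewrite ler_piMr //.
    by rewrite /fixpt_budget divr_ge0 ?mulr_ge0 ?sqr_ge0 ?ltW.
  by rewrite lerBlDl lerDr divr_ge0 ?sqr_ge0 ?exprn_ge0.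
elim: n => [|n ih]; first by rewrite big_ord0 !expr0 expr1n divr1 subrr mulr0.
rewrite big_ord_recr ih /= /fixpt_budget /fixpt (r1 n) (exprSr 2 n).
by field; rewrite rr rn0 q1.
Qed.

(** Bound for the last, uncompensated, cross term in the comparison of a state
    with the fixed point: only the products with a positive sign are kept. *)
Definition fixpt_leak n (x : nat -> R) : R :=
  2 * 2^-1 ^+ n * r ^+ (3 * n) *
    (x n * (fixpt n * fixpt n.+1) + fixpt n * (x n * x n.+1)).

(** The cross terms being eliminated, the damping term dominates
    [(x j - fixpt j) ^+ 2] uniformly in [j], since [fixpt] decays slowly enough
    when [3 / 2 < c]. The viscosity acts on [x] and not on the difference;
    completing the square leaves at most [nu * fixpt_budget]. *)
Lemma fixpt_comparison (nu : R) (x : nat -> R) n : 0 <= nu -> (forall j, 0 <= x j) ->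
  \sum_(j < n.+1) 2^-1 ^+ j *
    (2 * (x j - fixpt j) * dyadic_rhs r nu (A ^+ 2 / r) x j)
  <= - (A / r * \sum_(j < n) (x j - fixpt j) ^+ 2) + nu * fixpt_budget
     + fixpt_leak n x.
Proof.
move=> nu0 x0.
have -> : \sum_(j < n.+1) 2^-1 ^+ j *
    (2 * (x j - fixpt j) * dyadic_rhs r nu (A ^+ 2 / r) x j) =
  \sum_(j < n.+1) 2^-1 ^+ j *
    (2 * (x j - fixpt j) * (transport r x j - transport r fixpt j))
  - nu * \sum_(j < n.+1) 2^-1 ^+ j * (2 * (x j - fixpt j) * (2 ^+ (2 * j) * x j)).
  rewrite mulr_sumr -sumrB; apply: eq_bigr => j _.
  rewrite /dyadic_rhs; have := fixpt_stationary j => /(canRL (addrK _)) ->.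
  by rewrite sub0r; ring.
rewrite comparison_identity.
have visc : - (\sum_(j < n.+1) 2^-1 ^+ j *
    (2 * (x j - fixpt j) * (2 ^+ (2 * j) * x j))) <= fixpt_budget.
  apply: le_trans (fixpt_sum_le n.+1); rewrite -sumrN; apply: ler_sum => j _.
  have -> : 2^-1 ^+ j * (2 * (x j - fixpt j) * (2 ^+ (2 * j) * x j)) =
      2 ^+ j * (2 * (x j - fixpt j) * x j).
    rewrite exprVn mulnC exprM; have : (2 : R) ^+ j != 0 by rewrite expf_neq0.
    by move=> h; field.
  rewrite -mulrN ler_wpM2l ?exprn_ge0 //.
  have := sqr_ge0 (2 * x j - fixpt j); have := sqr_ge0 (fixpt j); nra.
have damp : A / r * \sum_(j < n) (x j - fixpt j) ^+ 2 <=
    \sum_(j < n) 2^-1 ^+ j * r ^+ (3 * j) * (x j.+1 + fixpt j.+1) * (x j - fixpt j) ^+ 2.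
  rewrite mulr_sumr; apply: ler_sum => j _; rewrite ler_wpM2r ?sqr_ge0 //.
  apply: (@le_trans _ _ (2^-1 ^+ j * r ^+ (3 * j) * fixpt j.+1)); last first.
    rewrite ler_wpM2l ?lerDr // mulr_ge0 ?exprn_ge0 ?invr_ge0 ?ltW //.
  have -> : 2^-1 ^+ j * r ^+ (3 * j) * fixpt j.+1 = A / r * (r ^+ 2 / 2) ^+ j.
    rewrite /fixpt r3 r1 expr_div_n (exprAC r 2) exprVn.
    have : (2 : R) ^+ j != 0 by rewrite expf_neq0.
    by move=> h; field; rewrite h rr rn0.
  apply: ler_peMr; first by rewrite divr_ge0 ?ltW.
  apply: exprn_ege1; by rewrite ler_pdivlMr // mul1r ltW.
have leak : - (2 * 2^-1 ^+ n * r ^+ (3 * n) * (x n - fixpt n) *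
    (x n * x n.+1 - fixpt n * fixpt n.+1)) <= fixpt_leak n x.
  rewrite -subr_ge0 (_ : _ - _ = 2 * 2^-1 ^+ n * r ^+ (3 * n) *
    (x n * (x n * x n.+1) + fixpt n * (fixpt n * fixpt n.+1))).
    have w0 : 0 <= 2 * 2^-1 ^+ n * r ^+ (3 * n).
      by rewrite !mulr_ge0 ?exprn_ge0 ?invr_ge0 // ltW.
    have := fixpt_ge0 n; have := fixpt_ge0 n.+1 => f1 f2.
    by apply: mulr_ge0 => //; apply: addr_ge0; do 2! [apply: mulr_ge0 => //].
  by rewrite /fixpt_leak; ring.
have := ler_wpM2l nu0 visc; lra.
Qed.

(** The product [x_n x_{n+1}] is split so that the first part is controlled by
    the energy flux and the second by the size of the state. *)
Lemma fixpt_leak_le (x : nat -> R) n (M : R) : (forall j, 0 <= x j) -> x n <= M -> x n.+1 <= M ->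
  fixpt_leak n x <= 2 * A ^+ 2 / r * M * (r / 2) ^+ n
    + 2 * A * M * (r ^+ 2 / 4) ^+ n + 2 * A * r^-1 ^+ n * flux r x n.
Proof.
move=> x0 xM xM'.
have h2 : (2 : R) ^+ n != 0 by rewrite expf_neq0.
have h4 : (4 : R) ^+ n = 2 ^+ n * 2 ^+ n by rewrite -exprMn -natrM.
have e1 : 2 * 2^-1 ^+ n * r ^+ (3 * n) * (x n * (fixpt n * fixpt n.+1)) =
    2 * A ^+ 2 / r * x n * (r / 2) ^+ n.
  by rewrite /fixpt r3 r1 expr_div_n exprVn; field; rewrite rr rn0 h2.
have e2 : 2 * 2^-1 ^+ n * r ^+ (3 * n) * (fixpt n * (x n * x n.+1)) =
    2 * A * (r ^+ n) ^+ 2 / 2 ^+ n * (x n * x n.+1).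
  by rewrite /fixpt r3 exprVn; field; rewrite rn0 h2.
have e3 : 2 * A * r^-1 ^+ n * flux r x n =
    2 * A * (r ^+ n) ^+ 2 / 2 ^+ n * (2 ^+ n * x n ^+ 2 * x n.+1).
  by rewrite /flux r3 exprVn; field; rewrite rn0 h2.
have e4 : 2 * A * x n.+1 * (r ^+ 2 / 4) ^+ n =
    2 * A * (r ^+ n) ^+ 2 / 2 ^+ n * (x n.+1 / 2 ^+ n).
  by rewrite expr_div_n (exprAC r 2) h4; field; rewrite h2.
have rge0 : 0 <= r by exact: ltW.
have Age0 : 0 <= A by exact: ltW.
have g1 : 0 <= (r / 2) ^+ n by rewrite exprn_ge0 ?divr_ge0.
have g2 : 0 <= (r ^+ 2 / 4) ^+ n by rewrite exprn_ge0 ?divr_ge0 ?sqr_ge0.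
have g3 : 0 <= 2 * A ^+ 2 / r by rewrite divr_ge0 ?mulr_ge0 ?sqr_ge0.
have g4 : 0 <= 2 * A * (r ^+ n) ^+ 2 / 2 ^+ n.
  by rewrite divr_ge0 ?mulr_ge0 ?sqr_ge0 ?exprn_ge0.
rewrite /fixpt_leak mulrDr e1 e2 e3 -addrA; apply: lerD.
  by apply: ler_wpM2r => //; apply: ler_wpM2l.
apply: (@le_trans _ _ (2 * A * x n.+1 * (r ^+ 2 / 4) ^+ n +
   2 * A * (r ^+ n) ^+ 2 / 2 ^+ n * (2 ^+ n * x n ^+ 2 * x n.+1))); last first.
  by rewrite lerD2r; apply: ler_wpM2r => //; apply: ler_wpM2l => //; rewrite mulr_ge0.
rewrite e4 -mulrDr; apply: ler_wpM2l => //.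
rewrite (_ : _ + _ = x n.+1 * ((2 ^+ n)^-1 + 2 ^+ n * x n ^+ 2)); last by ring.
rewrite mulrC; apply: ler_wpM2l => //.
have p0 : 0 < (2 : R) ^+ n by rewrite exprn_gt0.
rewrite -(ler_pM2l p0) mulrDr divff //.
have := sqr_ge0 (2 ^+ n * x n - 1); have := mulr_ge0 (ltW p0) (x0 n); nra.
Qed.

End Stationary.

(** * Attraction to the inviscid fixed point *)

Section Attraction.
Context {R : realType}.
Variables (r A nu : R) (x : nat -> R -> R) (B : R).
Hypotheses (r0 : 0 < r) (A0 : 0 < A) (r2 : 2 < r ^+ 2) (r6 : r ^+ 6 <= 32).
Hypothesis nu0 : 0 <= nu.
Hypothesis solx : regular_solution r nu (A ^+ 2 / r) x.
Hypothesis xB : forall n, \sum_(j < n) x j 0 ^+ 2 <= B.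

Let f00 : 0 <= A ^+ 2 / r. Proof. by rewrite divr_ge0 ?sqr_ge0 ?ltW. Qed.

Let x0 j t : 0 <= x j t. Proof. exact: (rs_ge0 solx). Qed.

Let cx j : continuous (x j). Proof. exact: (rs_cont solx). Qed.

Let alpha := fixpt r A.

Let W_C1 n : C1_with_deriv
  (fun t => \sum_(j < n.+1) 2^-1 ^+ j * (x j t - alpha j) ^+ 2)
  (fun t => \sum_(j < n.+1) 2^-1 ^+ j *
    (2 * (x j t - alpha j) * dyadic_rhs r nu (A ^+ 2 / r) (x^~ t) j)).
Proof.
have H j := C1_scale (2^-1 ^+ j) (C1_sq (C1_add (rs_C1 solx j) (C1_cst (- alpha j)))).
apply: C1_eq (C1_sum n.+1 H) _ => t.
by apply: eq_bigr => j _; congr (_ * _); rewrite addr0 mulrA.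
Qed.

Let r_lt2 : r < 2. Proof. exact: root_scale_lt2. Qed.

Let r_gt1 : 1 < r.
Proof.
by rewrite -(@ltr_pXn2r _ 2) ?nnegrE ?ltW // expr1n (lt_trans _ r2) ?ltr1n.
Qed.

(** The comparison of a solution with the fixed point, integrated in time and
    freed from its last term by letting the truncation order tend to infinity:
    the flux being integrable, [fixpt_leak] is bounded by geometric sequences. *)
Lemma fixpt_attraction N T : 0 <= T ->
  A / r * prim (fun t => \sum_(j < N) (x j t - alpha j) ^+ 2) T <=
  B + fixpt_budget r A + nu * fixpt_budget r A * T.
Proof.
move=> T0; set K := energy_budget (A ^+ 2 / r) x B T.
(* The three geometric errors of fixpt_leak_le, integrated over [0, T]. *)
pose e n := T * (2 * A ^+ 2 / r * (1 + K)) * (r / 2) ^+ n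
  + T * (2 * A * (1 + K)) * (r ^+ 2 / 4) ^+ n + A * K * r^-1 ^+ n.
apply: (@le_of_cvg0 _ _ _ e); last first.
  rewrite -[X in _ --> X](addr0 0) -[X in _ --> X + _](addr0 0).
  apply: cvgD; [apply: cvgD|]; apply: cvg_geom0.
  - by rewrite divr_ge0 ?ltW //= ltr_pdivrMr // mul1r.
  - rewrite divr_ge0 ?sqr_ge0 //= ltr_pdivrMr // mul1r; by have := r_lt2; have := r0; nra.
  - by rewrite invr_ge0 ltW //= invf_lt1.
exists N => // n /= Nn.
have b0 j : continuous (fun t => (x j t - alpha j) ^+ 2) by cont_tac; exact: cx.
have cS m : continuous (fun t => \sum_(j < m) (x j t - alpha j) ^+ 2).
  exact: (@cont_sum _ m (fun j t => (x j t - alpha j) ^+ 2)).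
have W0 : \sum_(j < n.+1) 2^-1 ^+ j * (x j 0 - alpha j) ^+ 2 <= B + fixpt_budget r A.
  apply: (@le_trans _ _ (\sum_(j < n.+1) x j 0 ^+ 2
      + \sum_(j < n.+1) 2 ^+ j * alpha j ^+ 2)); last first.
    by apply: lerD; [exact: xB | exact: fixpt_sum_le].
  rewrite -big_split /=; apply: ler_sum => j _.
  apply: (@le_trans _ _ ((x j 0 - alpha j) ^+ 2)).
    rewrite ler_piMl ?sqr_ge0 // exprn_ile1 ?invr_ge0 // invf_le1 //.
    by rewrite ler1n.
  apply: (@le_trans _ _ (x j 0 ^+ 2 + alpha j ^+ 2)).
    have := mulr_ge0 (x0 j 0) (fixpt_ge0 r0 A0 j); rewrite -/(alpha j); nra.
  by rewrite lerD2l ler_peMl ?sqr_ge0 // exprn_ege1 // ler1n.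
have WT : 0 <= \sum_(j < n.+1) 2^-1 ^+ j * (x j T - alpha j) ^+ 2.
  by apply: sumr_ge0 => j _; rewrite mulr_ge0 ?sqr_ge0 ?exprn_ge0 ?invr_ge0.
have cfl : continuous (fun t => flux r (x^~ t) n) by exact: (cont_flux solx).
pose g t := - (A / r) * (\sum_(j < N) (x j t - alpha j) ^+ 2) +
  (nu * fixpt_budget r A + 2 * A ^+ 2 / r * (1 + K) * (r / 2) ^+ n
    + 2 * A * (1 + K) * (r ^+ 2 / 4) ^+ n) + 2 * A * r^-1 ^+ n * flux r (x^~ t) n.
have cg : continuous g.
  by rewrite /g; cont_tac; [exact: cS | exact: cfl].
have [_ cf _] := W_C1 n.
have := le_prim (t := T) cf cg; rewrite (primE (W_C1 n) T0).
have -> : prim g T = - (A / r) * prim (fun t => \sum_(j < N) (x j t - alpha j) ^+ 2) T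
  + (nu * fixpt_budget r A + 2 * A ^+ 2 / r * (1 + K) * (r / 2) ^+ n
    + 2 * A * (1 + K) * (r ^+ 2 / 4) ^+ n) * T
  + 2 * A * r^-1 ^+ n * prim (fun t => flux r (x^~ t) n) T.
  rewrite /g primD; [|by cont_tac; exact: cS|by cont_tac; exact: cfl].
  rewrite primD; [|by cont_tac; exact: cS|exact: cont_cst].
  by rewrite prim_cst // primZ // primZ.
have fl := flux_int_le nu0 solx xB n T0.
have fl' : 2 * A * r^-1 ^+ n * prim (fun t => flux r (x^~ t) n) T <= A * K * r^-1 ^+ n.
  have h : 0 <= A * r^-1 ^+ n by rewrite mulr_ge0 ?exprn_ge0 ?invr_ge0 // ltW.
  have := ler_wpM2l h fl; rewrite -/K; lra.
move=> H.
suff : forall t, 0 <= t <= T -> \sum_(j < n.+1) 2^-1 ^+ j *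
    (2 * (x j t - alpha j) * dyadic_rhs r nu (A ^+ 2 / r) (x^~ t) j) <= g t.
  move=> /H; rewrite /e; lra.
move=> t t0T.
have xM j : x j t <= 1 + K by exact: (component_le r0 nu0 f00 solx xB).
have c1 := fixpt_comparison r0 A0 r2 n nu0 (fun j => x0 j t).
have c2 := fixpt_leak_le r0 A0 (fun j => x0 j t) (xM n) (xM n.+1).
have c3 : A / r * (\sum_(j < N) (x j t - alpha j) ^+ 2) <=
    A / r * (\sum_(j < n) (x j t - alpha j) ^+ 2).
  apply: ler_wpM2l; first by rewrite divr_ge0 ?ltW.
  rewrite -(subnKC Nn) big_split_ord /= lerDl.
  by apply: sumr_ge0 => j _; exact: sqr_ge0.
rewrite /g; move: c1 c2 c3; rewrite -/alpha; lra.
Qed.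

End Attraction.

(** * Long-time behaviour of inviscid solutions *)

Section Inviscid.
Context {R : realType}.
Variables (r A : R) (x : nat -> R -> R) (B : R).
Hypotheses (r0 : 0 < r) (A0 : 0 < A) (r2 : 2 < r ^+ 2) (r6 : r ^+ 6 <= 32).
Hypothesis solx : regular_solution r 0 (A ^+ 2 / r) x.
Hypothesis xB : forall n, \sum_(j < n) x j 0 ^+ 2 <= B.

Let f00 : 0 <= A ^+ 2 / r. Proof. by rewrite divr_ge0 ?sqr_ge0 ?ltW. Qed.

Let x0 j t : 0 <= x j t. Proof. exact: (rs_ge0 solx). Qed.

Let cx j : continuous (x j). Proof. exact: (rs_cont solx). Qed.

Let alpha := fixpt r A.

Let dev_int N T : 0 <= T ->
  prim (fun t => \sum_(j < N) (x j t - alpha j) ^+ 2) T <=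
  (B + fixpt_budget r A) / (A / r).
Proof.
move=> T0; have k0 : 0 < A / r by rewrite divr_gt0.
rewrite ler_pdivlMr // mulrC.
have := fixpt_attraction r0 A0 r2 r6 (lexx 0) solx xB N T0.
by rewrite !mul0r addr0.
Qed.

Lemma inviscid_average : T^-1 * prim (x 0%N) T @[T --> +oo] --> A.
Proof.
apply: (@average_of_sq _ _ _ ((B + fixpt_budget r A) / (A / r))) => [|T T0].
  exact: cx.
have := dev_int 1 T0; apply: le_trans; rewrite le_eqVlt; apply/orP; left; apply/eqP.
by congr prim; apply/funext => t; rewrite big_ord1 /alpha /fixpt expr0 divr1.
Qed.

(** Over a unit of time the final energy cannot exceed the average energy by
    more than twice the work of the force, and averages are controlled by the
    attraction to the fixed point. *)
Lemma inviscid_energy_bounded :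
  exists C, forall n T, 1 <= T -> \sum_(j < n) x j T ^+ 2 <= C.
Proof.
set f0 := A ^+ 2 / r; set c := 2 * fixpt_budget r A + 2 * f0 * (A + 1).
exists ((2 + 2 * f0) * ((B + fixpt_budget r A) / (A / r)) + c) => n T T1.
pose S t := \sum_(j < n.+1) x j t ^+ 2.
pose b t := \sum_(j < n.+1) (x j t - alpha j) ^+ 2.
have cS := energy_C1 solx n.
(* The factor t - (T - 1) vanishes at T - 1 and equals 1 at T. *)
have cPhi := C1_mul (C1_add (C1_id (R := R)) (C1_cst (1 - T))) cS.
have cb : continuous b.
  by apply: (@cont_sum _ n.+1 (fun j t => (x j t - alpha j) ^+ 2)) => j; cont_tac; exact: cx.
have T0 : 0 <= T by rewrite (le_trans _ T1).
have T10 : 0 <= T - 1 by rewrite subr_ge0.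
have [_ cd _] := cPhi.
have b0 t : 0 <= b t by apply: sumr_ge0 => j _; exact: sqr_ge0.
pose g t := (2 + 2 * f0) * b t + c.
have cg : continuous g by rewrite /g; cont_tac.
have primg u : 0 <= u -> prim g u = (2 + 2 * f0) * prim b u + c * u.
  move=> u0; rewrite /g primD; [|by cont_tac|exact: cont_cst].
  by rewrite primZ // prim_cst.
have f0_ge0 : 0 <= f0 := f00.
have TT : 0 <= T - 1 <= T by rewrite T10 lerBlDr lerDl ler01.
have key := le_primB cd cg TT.
move: key; rewrite (primE cPhi T0) (primE cPhi T10) !primg // => key.
apply: (@le_trans _ _ (S T)); first by rewrite /S big_ord_recr /= lerDl sqr_ge0.
have db := dev_int n.+1 T0; rewrite -/b in db.
have db1 : 0 <= prim b (T - 1) by apply: prim_ge0 => t _; exact: b0.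
have f2 : 0 <= 2 + 2 * f0 by lra.
have := ler_wpM2l f2 db; have := mulr_ge0 f2 db1.
suff hyp t : T - 1 <= t <= T ->
    (t + (1 - T)) * (2 * (f0 * x 0%N t - flux r (x^~ t) n - 0 * enstrophy x n t))
    + S t * (1 + 0) <= g t.
  move: key => /(_ hyp); rewrite -/(S T) -/(S (T - 1)); lra.
move=> /andP[tl tr].
have Sb : S t <= 2 * b t + 2 * fixpt_budget r A.
  have := fixpt_sum_le r0 A0 r2 n.+1.
  suff : S t <= 2 * b t + 2 * \sum_(j < n.+1) 2 ^+ j * alpha j ^+ 2 by rewrite -/alpha; lra.
  rewrite /S /b !mulr_sumr -big_split /=; apply: ler_sum => j _.
  apply: (@le_trans _ _ (2 * (x j t - alpha j) ^+ 2 + 2 * alpha j ^+ 2)).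
    by have := sqr_ge0 (x j t - 2 * alpha j); nra.
  rewrite lerD2l; apply: ler_wpM2l => //.
  by apply: ler_peMl; [exact: sqr_ge0 | apply: exprn_ege1; rewrite ler1n].
have x0b : x 0%N t <= A + 1 + b t.
  have : (x 0%N t - A) ^+ 2 <= b t.
    rewrite /b big_ord_recl /= /alpha /fixpt expr0 divr1 lerDl.
    by apply: sumr_ge0 => j _; exact: sqr_ge0.
  by have := sqr_ge0 (x 0%N t - A - 1); nra.
have Phi : (t + (1 - T)) * (2 * (f0 * x 0%N t - flux r (x^~ t) n - 0 * enstrophy x n t))
    <= 2 * f0 * x 0%N t.
  have fl := flux_ge0 r0 solx n t.
  have h := mulr_ge0 f0_ge0 (x0 0%N t).
  have h1 : 0 <= t + (1 - T) by lra.
  have h2 : t + (1 - T) <= 1 by lra.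
  have := mulr_ge0 h1 fl; have := ler_wpM2r h h2.
  rewrite mul0r subr0; nra.
have := ler_wpM2l f0_ge0 x0b; rewrite /g /c; lra.
Qed.

End Inviscid.

(** * Integration by parts for Stieltjes measures *)

Section Stieltjes.
Context {R : realType}.
Variable F : cumulative R R.
Notation muF := (lebesgue_stieltjes_measure F).
Notation mu := (@lebesgue_measure R).

Lemma stieltjes_itvoc (a b : R) : a <= b ->
  muF `]a, b]%classic = (F b - F a)%:E.
Proof.
move=> ab; rewrite /lebesgue_stieltjes_measure /= /measure_extension /=.
rewrite measurable_mu_extE /=; last exact: is_ocitv.
by rewrite wlength_itv_bnd.
Qed.

Variables (phi g : R -> R) (Y : R).
Hypotheses (Y0 : 0 < Y) (phiC1 : C1_with_deriv phi g).
Hypothesis phiY : forall t, Y <= t -> phi t = 0.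

Let cg : continuous g. Proof. by have [] := phiC1. Qed.

Let E : set (measurableTypeR R * measurableTypeR R) :=
  [set z | 0 < z.1 /\ z.1 <= z.2 <= Y].

Let mE : measurable E.
Proof.
have mf1 : measurable_fun setT (fun z : measurableTypeR R * measurableTypeR R => z.1 : R).
  exact: measurable_fst.
have mf2 : measurable_fun setT (fun z : measurableTypeR R * measurableTypeR R => z.2 : R).
  exact: measurable_snd.
have mf3 : measurable_fun setT (fun z : measurableTypeR R * measurableTypeR R => (z.2 : R) - z.1).
  exact: measurable_funB.
have -> : E = (fun z : measurableTypeR R * measurableTypeR R => z.1 : R) @^-1` `]0, +oo[
    `&` ((fun z : measurableTypeR R * measurableTypeR R => (z.2 : R) - z.1) @^-1` `[0, +oo[
     `&` (fun z : measurableTypeR R * measurableTypeR R => z.2 : R) @^-1` `]-oo, Y]).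
  apply/seteqP; split => z; rewrite /E /= !in_itv /= !andbT subr_ge0.
    by move=> [-> /andP[-> ->]].
  by move=> [-> [-> ->]].
rewrite -[X in measurable (X `&` _)]setTI -[X in measurable (_ `&` (X `&` _))]setTI
  -[X in measurable (_ `&` (_ `&` X))]setTI.
by apply: measurableI; [apply: mf1|apply: measurableI; [apply: mf3|apply: mf2]].
Qed.

Let f (z : measurableTypeR R * measurableTypeR R) : \bar R :=
  (\1_E z * - g z.2)%:E.

Let mf : measurable_fun setT f.
Proof.
apply/measurable_EFinP; apply: measurable_funM; first exact: measurable_indic.
apply: measurableT_comp => //; apply: measurableT_comp; last exact: measurable_snd.
exact: continuous_measurable_fun.
Qed.

Let mfs t : measurable_fun setT (fun s : measurableTypeR R => f (t, s)).
Proof. exact: measurableT_comp mf (pair1_measurable _). Qed.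

Let mft s : measurable_fun setT (fun t : measurableTypeR R => f (t, s)).
Proof. exact: measurableT_comp mf (pair2_measurable _). Qed.

Let fE t s : f (t, s) = if (0 < t) && (t <= s) && (s <= Y) then (- g s)%:E else 0%E.
Proof.
rewrite /f /= indicE; case: ifPn => h.
  by rewrite mem_set ?mul1r //= /E /=; move: h => /andP[/andP[-> ->] ->].
rewrite memNset ?mul0r //= /E /= => -[a b]; move: h.
by rewrite a b.
Qed.

Let int_s t : (\int[mu]_s f (t, s) = (if 0 < t then phi t else 0)%:E)%E.
Proof.
case: ltP => t0; last first.
  rewrite integral0_eq // => s _; rewrite fE ltNge t0 //.
have [tY|Yt] := lerP t Y; last first.
  rewrite phiY ?ltW // integral0_eq // => s _; rewrite fE; case: ifPn => //.
  by move=> /andP[/andP[_ ts] sY]; have := le_trans ts sY; rewrite leNgt Yt.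
have CN := C1_opp phiC1.
transitivity (\int[mu]_(s in `[t, Y]) (- g s)%:E)%E.
  rewrite [RHS]integral_mkcond; apply: eq_integral => s _.
  rewrite fE t0 /= patchE; case: ifPn => h.
    by rewrite mem_set //= in_itv.
  by rewrite memNset //= in_itv /=; exact/negP.
by rewrite (integral_C1 CN) ?(ltW t0) // phiY // oppr0 sub0r opprK.
Qed.

Let int_t s : 0 <= s <= Y ->
  (\int[muF]_t f (t, s) = (- g s * (F s - F 0))%:E)%E.
Proof.
move=> /andP[s0 sY].
transitivity (\int[muF]_(t in `]0%R, s]) (- g s)%:E)%E.
  rewrite [RHS]integral_mkcond; apply: eq_integral => t _.
  rewrite fE sY andbT patchE; case: ifPn => h.
    by rewrite mem_set //= in_itv.
  by rewrite memNset //= in_itv /=; exact/negP.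
by rewrite integral_cst //= stieltjes_itvoc // EFinM.
Qed.

Let intf : (muF \x mu)%E.-integrable setT f.
Proof.
apply/integrable12ltyP => //.
have cag : continuous (fun s => `|g s|).
  by move=> s; apply: cvg_norm; exact: cg.
set C := prim (fun s => `|g s|) Y.
apply: (@le_lt_trans _ _ (\int[muF]_(t in `]0%R, Y]) C%:E)%E); last first.
  by rewrite integral_cst //= stieltjes_itvoc ?(ltW Y0) // -EFinM ltry.
rewrite [leRHS]integral_mkcond; apply: ge0_le_integral => //.
- by move=> t _; apply: integral_ge0.
- apply: (@measurable_fun_fubini_tonelli_F _ _ _ _ _ mu (abse \o f)).
    exact: measurableT_comp.
  by move=> z; exact: abse_ge0.
- apply/measurable_restrict => //; exact: measurable_cst.
move=> t _; rewrite patchE; case: ifPn => [_|].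
  apply: (@le_trans _ _ (\int[mu]_(s in `[0%R, Y]) `|g s|%:E)%E).
    rewrite [leRHS]integral_mkcond; apply: ge0_le_integral => //.
    + exact: measurableT_comp.
    + apply/measurable_restrict => //; apply/measurable_EFinP.
      by apply: measurable_funTS; exact: continuous_measurable_fun.
    move=> s _; rewrite fE patchE; case: ifPn => h.
      rewrite mem_set ?abseN //= ?normrN // in_itv /=.
      by move: h => /andP[/andP[t0 ts] ->]; rewrite (le_trans (ltW t0) ts).
    by rewrite abse0; case: ifP.
  rewrite (integral_C1 (C1_prim cag)) ?lexx ?(ltW Y0) //.
  by rewrite prim0 subr0.
move=> h; rewrite integral0_eq // => s _; rewrite fE; case: ifPn; rewrite ?abse0 //.
move=> /andP[/andP[t0 ts] sY]; move: h; rewrite notin_setE /= in_itv /= t0 /=.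
by rewrite (le_trans ts sY).
Qed.

(** Integration by parts against a Stieltjes measure: [phi t] is minus the
    integral of its derivative from [t] to [Y], and the order of integration over
    the triangle [0 < t <= s <= Y] is exchanged. *)
Lemma stieltjes_by_parts :
  (\int[muF]_(t in `]0%R, +oo[) (phi t)%:E =
   \int[mu]_(s in `[0%R, Y]) (- g s * (F s - F 0))%:E)%E.
Proof.
transitivity (\int[muF]_t \int[mu]_s f (t, s))%E.
  rewrite integral_mkcond; apply: eq_integral => t _.
  rewrite int_s patchE; case: ifPn.
    by rewrite inE /= in_itv /= andbT => ->.
  by rewrite notin_setE /= in_itv /= andbT => /negP/negbTE ->.
rewrite (Fubini intf) [RHS]integral_mkcond; apply: eq_integral => s _.
rewrite patchE; case: ifPn => h.
  by apply: int_t; rewrite inE /= in_itv /= in h.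
rewrite integral0_eq // => t _; rewrite fE; case: ifPn => //.
move=> /andP[/andP[t0 ts] sY]; move: h; rewrite notin_setE /= in_itv /= sY andbT.
by rewrite (le_trans (ltW t0) ts).
Qed.

End Stieltjes.

(** * The anomalous dissipation measure *)

Section SquareNorm.
Context {R : realType}.
Implicit Types u : nat -> R.

Lemma l2_sqnorm_cvg u : l2 u -> \sum_(j < n) u j ^+ 2 @[n --> \oo] --> l2_sqnorm u.
Proof.
move=> lu; rewrite (_ : (fun n => _) = series (fun j => u j ^+ 2)).
  exact: lu.
by apply/funext => n; rewrite /series /= big_mkord.
Qed.

Lemma l2_sqnorm_le u (C : R) : l2 u -> (forall n, \sum_(j < n) u j ^+ 2 <= C) ->
  l2_sqnorm u <= C.
Proof.
move=> lu uC; rewrite -(cvg_lim _ (l2_sqnorm_cvg lu)) //.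
apply: limr_le; first by apply/cvg_ex; exists (l2_sqnorm u); exact: l2_sqnorm_cvg.
by near=> n; exact: uC.
Unshelve. all: by end_near. Qed.

Lemma l2_pairing_force0 u (f0 : R) : l2_pairing u (force0 f0) = f0 * u 0%N.
Proof.
rewrite /l2_pairing; apply/cvg_lim => //; apply: cvg_near_cst.
exists 1%N => // n /= n1; rewrite /series /= big_mkord.
case: n n1 => // n _; rewrite big_ord_recl /= big1 /force0 /=.
  by rewrite addr0 mulrC.
by move=> j _; rewrite mulr0.
Qed.

End SquareNorm.

Section Dissipation.
Context {R : realType}.
Variables (r f0 : R) (x : nat -> R -> R).
Hypothesis r0 : 0 < r.
Hypothesis solx : regular_solution r 0 f0 x.
Hypothesis xmax : forall j t, x j (Num.max 0 t) = x j t.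
Hypothesis xl2 : forall t, l2 (x^~ t).

Let cx j : continuous (x j). Proof. exact: (rs_cont solx). Qed.

Definition sqn t := l2_sqnorm (x^~ t).

(** Work of the force minus kinetic energy: a primitive of the dissipation. *)
Definition dissipated t := f0 * prim (x 0%N) t - 2^-1 * sqn t.

Let dissipated_max t : dissipated (Num.max 0 t) = dissipated t.
Proof.
rewrite /dissipated prim_max0 /sqn; congr (_ - _ * l2_sqnorm _).
by apply/funext => j; exact: xmax.
Qed.

Lemma dissipated_nondecreasing : nondecreasing dissipated.
Proof.
suff H s t : 0 <= s <= t -> dissipated s <= dissipated t.
  move=> s t st; rewrite -dissipated_max -(dissipated_max t); apply: H.
  by rewrite le_max lexx /= ge_max !le_max lexx st orbT.
move=> st; have /andP[s0 le_st] := st; have t0 := le_trans s0 le_st.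
suff : sqn t <= sqn s + 2 * f0 * (prim (x 0%N) t - prim (x 0%N) s).
  by rewrite /dissipated; lra.
apply: l2_sqnorm_le => // n.
apply: (@le_trans _ _ (\sum_(j < n.+1) x j s ^+ 2 + 2 * f0 * (prim (x 0%N) t - prim (x 0%N) s))).
  apply: (@le_trans _ _ (\sum_(j < n.+1) x j t ^+ 2)).
    by rewrite big_ord_recr /= lerDl sqr_ge0.
  have := energy_balance solx n t0; have := energy_balance solx n s0.
  have := prim_mono (cont_flux solx (n := n)) (flux_ge0 r0 solx n) st.
  by lra.
by rewrite lerD2r; exact: l2_partial_le.
Qed.

(** The energy is a supremum of continuous functions, so the monotone function
    [dissipated] is upper semicontinuous, hence right continuous. *)
Lemma dissipated_right_continuous : right_continuous dissipated.
Proof.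
move=> t; apply/cvgrPdist_le => e e0.
have [n hn] : exists n, sqn t - e <= \sum_(j < n) x j t ^+ 2.
  have /cvgrPdist_le /(_ e e0) [n _ /(_ n (leqnn n))] := l2_sqnorm_cvg (@xl2 t).
  rewrite -/(sqn t) ler_norml => /andP[_ h]; exists n; lra.
have cS : continuous (fun s => f0 * prim (x 0%N) s - 2^-1 * \sum_(j < n) x j s ^+ 2).
  have [cP _ _] := C1_prim (cx (j := 0%N)).
  cont_tac; first exact: cP.
  by apply: (@cont_sum _ n (fun j s => x j s ^+ 2)) => j; cont_tac; exact: cx.
have e2 : 0 < e / 2 by rewrite divr_gt0.
have /cvgrPdist_le /(_ _ e2) h := cS t.
have h' : \forall s \near t^'+, `|f0 * prim (x 0%N) t - 2^-1 * (\sum_(j < n) x j t ^+ 2) -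
    (f0 * prim (x 0%N) s - 2^-1 * (\sum_(j < n) x j s ^+ 2))| <= e / 2.
  exact: (cvg_within _ h).
near=> s.
have ts : t <= s by near: s; exact: nbhs_right_ge.
have := dissipated_nondecreasing ts.
have := l2_partial_le n (@xl2 s).
have : `|f0 * prim (x 0%N) t - 2^-1 * (\sum_(j < n) x j t ^+ 2) -
    (f0 * prim (x 0%N) s - 2^-1 * (\sum_(j < n) x j s ^+ 2))| <= e / 2 by near: s.
rewrite !ler_norml -/(sqn s) /dissipated => /andP[a b] c d.
by apply/andP; split; lra.
Unshelve. all: by end_near. Qed.

Definition dissipated_cumulative : cumulative R R :=
  HB.pack_for (cumulative R R) dissipated
    (isCumulative.Build R _ R dissipated dissipated_nondecreasing dissipated_right_continuous).

Definition dissipation_measure : {measure set (measurableTypeR R) -> \bar R} :=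
  lebesgue_stieltjes_measure dissipated_cumulative.

Lemma dissipation_measure_itv T : 0 <= T ->
  dissipation_measure `]0, T]%classic = (dissipated T - dissipated 0)%:E.
Proof. by move=> T0; rewrite /dissipation_measure /= stieltjes_itvoc. Qed.

Lemma measurable_dissipated : measurable_fun setT dissipated.
Proof.
apply: nondecreasing_measurable => // s t st.
exact: dissipated_nondecreasing.
Qed.

Lemma test_function_C1 (phi : R -> R) : test_function phi -> C1_with_deriv phi (derive1 phi).
Proof.
move=> [dphi _].
have cont n : continuous (derive1n n phi).
  by move=> t; apply: differentiable_continuous; apply/derivable1_diffP; exact: dphi.
split; [exact: (cont 0%N) | exact: (cont 1%N) |].
by move=> t _; apply: DeriveDef; [exact: (dphi 0%N) | rewrite derive1E].
Qed.

(** The integrand of the distribution differs from the one given by integration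
    by parts by the derivative of
    [phi * (f0 * prim (x 0) - dissipated 0)], whose integral vanishes. *)
Lemma dissipation_measureP (a : R -> nat -> R) :
  (forall t, 0 < t -> a t = x^~ t) ->
  anomalous_dissipation (force0 f0) a dissipation_measure.
Proof.
move=> ax phi tphi; have C1 := test_function_C1 tphi; have [_ cdphi _] := C1.
have [_ [u [v [u0 phi0]]]] := tphi.
(* phi vanishes from v on, hence also its derivative beyond Y > v. *)
pose Y := Num.max v 0 + 1.
have Y0 : 0 < Y by rewrite ltr_wpDl // le_max lexx orbT.
have vY : v < Y by rewrite (le_lt_trans (y := Num.max v 0)) ?le_max ?lexx // ltrDl.
have phiv t : v < t -> phi t = 0.
  by move=> vt; apply: phi0; rewrite in_itv /= negb_and orbC -ltNge vt.
have phiY t : Y <= t -> phi t = 0 by move=> Yt; apply: phiv; exact: lt_le_trans Yt.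
have phi00 : phi 0 = 0 by apply: phi0; rewrite in_itv /= negb_and -ltNge u0.
have dphiY t : Y < t -> derive1 phi t = 0.
  move=> Yt; rewrite derive1E (near_eq_derive (g := cst 0)) ?derive_cst //.
  near=> s; apply: phiv; near: s; apply: lt_nbhsr; exact: lt_trans Yt.
have mG := measurable_dissipated.
have mdphi : measurable_fun setT (derive1 phi) by exact: continuous_measurable_fun.
have [cphi _ _] := C1.
have cP : C1_with_deriv (prim (x 0%N)) (x 0%N) by apply: C1_prim; exact: cx.
have cPsi := C1_mul C1 (C1_add (C1_scale f0 cP) (C1_cst (- dissipated 0))).
have [_ cpsi _] := cPsi.
pose h s := - derive1 phi s * (dissipated s - dissipated 0).
pose k s := phi s * (f0 * x 0%N s) + 2^-1 * (derive1 phi s * sqn s).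
pose d s := phi s * (f0 * x 0%N s + 0)
   + (f0 * prim (x 0%N) s + - dissipated 0) * derive1 phi s.
have kE s : k s = h s + d s by rewrite /k /h /d /dissipated; ring.
have mh : measurable_fun setT h.
  apply: measurable_funM; first exact: measurableT_comp.
  by apply: measurable_funB => //; exact: measurable_cst.
have md : measurable_fun setT d by exact: continuous_measurable_fun.
have mk : measurable_fun setT k.
  by rewrite (_ : k = h \+ d); [exact: measurable_funD | apply/funext].
have ih : (@lebesgue_measure R).-integrable `[0, Y] (EFin \o h).
  have cb : continuous (fun s => (dissipated Y - dissipated 0) * `|derive1 phi s|).
    cont_tac => s; apply: cvg_norm; exact: cdphi.
  apply: le_integrable (integrable_continuous 0 Y cb) => //.
    by apply/measurable_EFinP; exact: measurable_funTS.
  move=> s; rewrite /= in_itv /= => /andP[s0 sY]; rewrite lee_fin /h.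
  have G1 := dissipated_nondecreasing s0; have G2 := dissipated_nondecreasing sY.
  have a1 : 0 <= dissipated s - dissipated 0 by rewrite subr_ge0.
  have a2 : dissipated s - dissipated 0 <= dissipated Y - dissipated 0 by rewrite lerD2r.
  rewrite !normrM normrN normr_id mulrC; apply: ler_wpM2r => //.
  by rewrite (ger0_norm a1) (ger0_norm (le_trans a1 a2)).
have id : (@lebesgue_measure R).-integrable `[0, Y] (EFin \o d) by exact: integrable_continuous.
rewrite /dissipation_measure (stieltjes_by_parts dissipated_cumulative Y0 C1 phiY).
transitivity (\int[lebesgue_measure]_(t in `[0%R, Y]) (h t + d t)%:E)%E.
  transitivity (\int[lebesgue_measure]_(t in `[0%R, Y]) ((h t)%:E + (d t)%:E))%E; last first.
    by apply: eq_integral => s _; rewrite EFinD.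
  rewrite integralD //= (integral_C1 cPsi) ?lexx ?(ltW Y0) //.
  by rewrite phi00 phiY // !mul0r subrr adde0.
transitivity (\int[lebesgue_measure]_(t in `[0%R, Y]) (k t)%:E)%E.
  by apply: eq_integral => s _; rewrite kE.
rewrite -integral_itv_obnd_cbnd; last by apply/measurable_EFinP; exact: measurable_funTS.
rewrite integral_mkcond [RHS]integral_mkcond; apply: eq_integral => s _.
rewrite !patchE; case: (ltP 0 s) => s0; last first.
  by rewrite !memNset //= in_itv /= ltNge s0.
rewrite [in RHS]mem_set /=; last by rewrite in_itv /= s0.
case: (lerP s Y) => sY.
  rewrite mem_set /=; last by rewrite in_itv /= s0.
  by rewrite /k ax // l2_pairing_force0.
rewrite memNset /=; last by rewrite in_itv /= s0 leNgt sY.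
by rewrite phiY ?ltW // dphiY // !mul0r mulr0 addr0.
Unshelve. all: by end_near. Qed.

End Dissipation.

(** * Contraction for viscous solutions *)

Section Viscous.
Context {R : realType}.
Variables (r nu f0 : R).
Hypotheses (r0 : 0 < r) (r6 : r ^+ 6 <= 32) (nu0 : 0 < nu) (f00 : 0 <= f0).

Let r3_8 : 0 <= r ^+ 3 / 8 < 1. Proof. exact: cube_ratio_lt1. Qed.

(** The energy satisfies a linear inequality with damping rate [nu], since the
    enstrophy dominates the energy. *)
Lemma viscous_energy_bounded x B : regular_solution r nu f0 x ->
  (forall n, \sum_(j < n) x j 0 ^+ 2 <= B) ->
  forall n t, 0 <= t -> \sum_(j < n) x j t ^+ 2 <= B + f0 ^+ 2 / nu ^+ 2.
Proof.
move=> solx xB n t t0.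
apply: (@le_trans _ _ (\sum_(j < n.+1) x j t ^+ 2)).
  by rewrite big_ord_recr /= lerDl sqr_ge0.
rewrite -subr_ge0.
(* f0 ^+ 2 / nu ^+ 2 is the equilibrium of S' = f0 ^+ 2 / nu - nu S. *)
have cz := C1_add (C1_cst (B + f0 ^+ 2 / nu ^+ 2)) (C1_opp (energy_C1 solx n)).
apply: (linear_ineq_ge0 cz (cont_cst (k := nu))) => //.
  rewrite addrAC addr_ge0 ?divr_ge0 ?sqr_ge0 // subr_ge0; exact: xB.
move=> s _; set S := \sum_(j < n.+1) _.
have fl := flux_ge0 r0 solx n s.
have SE : S <= enstrophy x n s.
  by apply: ler_sum => j _; rewrite ler_peMl ?sqr_ge0 // exprn_ege1 // ler1n.
have xS : x 0%N s ^+ 2 <= S.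
  by rewrite /S big_ord_recl lerDl; apply: sumr_ge0 => j _; exact: sqr_ge0.
have sq : 2 * f0 * x 0%N s <= nu * x 0%N s ^+ 2 + f0 ^+ 2 / nu.
  rewrite -subr_ge0 (_ : _ - _ = (nu * x 0%N s - f0) ^+ 2 / nu).
    by rewrite divr_ge0 ?sqr_ge0 // ltW.
  by field; rewrite gt_eqF.
have nE : nu * (f0 ^+ 2 / nu ^+ 2) = f0 ^+ 2 / nu by field; rewrite gt_eqF.
have B0 : 0 <= nu * B.
  by apply: mulr_ge0; [exact: ltW | have := xB 0%N; rewrite big_ord0].
have := ler_wpM2l (ltW nu0) SE; have := ler_wpM2l (ltW nu0) xS.
rewrite mulNr mulrDr mulrDr nE; lra.
Qed.

Lemma translate_solution x B h : 0 <= h -> regular_solution r nu f0 x ->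
  (forall n, \sum_(j < n) x j h ^+ 2 <= B) ->
  regular_solution r nu f0 (fun j t => x j (t + h)).
Proof.
move=> h0 solx xB; have cx j := rs_cont solx (j := j).
have cs : continuous (fun t : R => t + h) by cont_tac.
have cxh j : continuous (fun t => x j (t + h)).
  by move=> t; apply: (@continuous_comp _ _ _ (fun t : R => t + h) (x j)); [exact: cs | exact: cx].
split => [j|j t|].
- split; [exact: cxh | exact: (@cont_rhs _ r nu f0 (fun j t => x j (t + h))) |].
  move=> t t0; have [_ _ dx] := rs_C1 solx j.
  have th : 0 < t + h by rewrite ltr_wpDr.
  have dsh : is_derive t (1 : R) (fun s : R => s + h) 1.
    rewrite -[X in is_derive _ _ _ X]addr0.
    exact: (is_deriveD (is_derive_id t 1) (is_derive_cst h t 1)).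
  have := @is_derive1_comp _ (x j) (fun s : R => s + h) t _ _ (dx _ th) dsh.
  by rewrite mulr1.
- exact: (rs_ge0 solx).
- by exists B => n; under eq_bigr do rewrite add0r.
Qed.

(** The weighted distance [w] of two solutions satisfies [w' <= - 2 nu w], up to
    the last cross term; that term is at most a multiple of
    [(r ^+ 3 / 8) ^+ n] times the enstrophies, whose time integrals are bounded.
    Multiplying by [1 + 2 nu t] instead of an exponential still gives decay. *)
Lemma viscous_contraction x y Bx By :
  regular_solution r nu f0 x -> (forall n, \sum_(j < n) x j 0 ^+ 2 <= Bx) ->
  regular_solution r nu f0 y -> (forall n, \sum_(j < n) y j 0 ^+ 2 <= By) ->
  forall j T, 0 <= T ->
  (1 + 2 * nu * T) * (2^-1 ^+ j * (x j T - y j T) ^+ 2) <= Bx + By.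
Proof.
move=> solx xB soly yB j T T0.
have cx i := rs_cont solx (j := i); have cy i := rs_cont soly (j := i).
have x0 := rs_ge0 solx; have y0 := rs_ge0 soly.
set Kx := energy_budget f0 x Bx T; set Ky := energy_budget f0 y By T.
pose M := (1 + Kx) + (1 + Ky).
have xK i t : 0 <= t <= T -> x i t <= 1 + Kx.
  by apply: (component_le r0 (ltW nu0) f00 solx xB).
have yK i t : 0 <= t <= T -> y i t <= 1 + Ky.
  by apply: (component_le r0 (ltW nu0) f00 soly yB).
have Kx0 : 0 <= 1 + Kx by apply: le_trans (x0 0%N 0) (xK _ _ _); rewrite lexx.
have Ky0 : 0 <= 1 + Ky by apply: le_trans (y0 0%N 0) (yK _ _ _); rewrite lexx.
have M0 : 0 <= M by exact: addr_ge0.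
have T1 : 0 <= 1 + 2 * nu * T by rewrite addr_ge0 ?mulr_ge0 // ltW.
pose k := (1 + 2 * nu * T) * (2 * M).
have k0 : 0 <= k by rewrite mulr_ge0 // mulr_ge0.
pose e n := k * ((Kx + Ky) / (2 * nu)) * (r ^+ 3 / 8) ^+ n.
apply: (@le_of_cvg0 _ _ _ e); last exact: cvg_geom0.
exists j => // n /= jn.
pose b i t := x i t - y i t.
pose w t := \sum_(i < n.+1) 2^-1 ^+ i * b i t ^+ 2.
pose dw t := \sum_(i < n.+1) 2^-1 ^+ i *
  (2 * b i t * (dyadic_rhs r nu f0 (x^~ t) i - dyadic_rhs r nu f0 (y^~ t) i)).
have w_C1 : C1_with_deriv w dw.
  have H i := C1_scale (2^-1 ^+ i) (C1_sq (C1_add (rs_C1 solx i) (C1_opp (rs_C1 soly i)))).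
  apply: C1_eq (C1_sum n.+1 H) _ => t.
  by apply: eq_bigr => i _; congr (_ * _); rewrite mulrA.
have w0 t : 0 <= w t.
  by apply: sumr_ge0 => i _; rewrite mulr_ge0 ?sqr_ge0 ?exprn_ge0 ?invr_ge0.
have wj : 2^-1 ^+ j * (x j T - y j T) ^+ 2 <= w T.
  have jn1 : (j < n.+1)%N by [].
  rewrite /w (bigD1 (Ordinal jn1)) //= /b lerDl.
  by apply: sumr_ge0 => i _; rewrite mulr_ge0 ?sqr_ge0 ?exprn_ge0 ?invr_ge0.
have w00 : w 0 <= Bx + By.
  apply: le_trans (lerD (xB n.+1) (yB n.+1)).
  rewrite -big_split /=; apply: ler_sum => i _.
  apply: (@le_trans _ _ (b i 0 ^+ 2)).
    rewrite ler_piMl ?sqr_ge0 // exprn_ile1 ?invr_ge0 // invf_le1 //.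
    by rewrite ler1n.
  have := mulr_ge0 (x0 i 0) (y0 i 0); rewrite /b; nra.
have cPhi := C1_mul (C1_add (C1_cst 1) (C1_scale (2 * nu) (C1_id (R := R)))) w_C1.
have [_ cd _] := cPhi.
have cEx := cont_enstrophy solx (n := n); have cEy := cont_enstrophy soly (n := n).
pose g t := k * (r ^+ 3 / 8) ^+ n * (enstrophy x n t + enstrophy y n t).
have cg : continuous g by rewrite /g; cont_tac; [exact: cEx | exact: cEy].
have key := le_prim (t := T) cd cg.
have primg : prim g T <= e n.
  rewrite /g primZ ?primD //; last by apply: cont_add; [exact: cEx | exact: cEy].
  have h1 := enstrophy_int_le r0 solx xB n T0.
  have h2 := enstrophy_int_le r0 soly yB n T0.
  have nu2 : 0 < 2 * nu by rewrite mulr_gt0.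
  have h3 : prim (enstrophy x n) T + prim (enstrophy y n) T <= (Kx + Ky) / (2 * nu).
    by rewrite ler_pdivlMr // mulrC mulrDr lerD.
  rewrite /e [leRHS]mulrAC; apply: ler_wpM2l => //.
  by rewrite mulr_ge0 ?exprn_ge0 //; case/andP : r3_8.
move: key; rewrite (primE cPhi T0) mulr0 addr0 mul1r => key.
suff hyp t : 0 <= t <= T -> (1 + 2 * nu * t) * dw t + w t * (0 + 2 * nu * 1) <= g t.
  have := key hyp; have := ler_wpM2l T1 wj; lra.
move=> tT; have /andP[t0 le_tT] := tT.
have dwE : dw t = \sum_(i < n.+1) 2^-1 ^+ i *
    (2 * (x i t - y i t) * (transport r (x^~ t) i - transport r (y^~ t) i))
    - 2 * nu * \sum_(i < n.+1) 2^-1 ^+ i * (2 ^+ (2 * i) * b i t ^+ 2).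
  rewrite mulr_sumr -sumrB; apply: eq_bigr => i _.
  by rewrite /dyadic_rhs /b; ring.
have visc : w t <= \sum_(i < n.+1) 2^-1 ^+ i * (2 ^+ (2 * i) * b i t ^+ 2).
  apply: ler_sum => i _; apply: ler_wpM2l; first by rewrite exprn_ge0 ?invr_ge0.
  by rewrite ler_peMl ?sqr_ge0 // exprn_ege1 // ler1n.
have damp : 0 <= \sum_(i < n) 2^-1 ^+ i * r ^+ (3 * i) * (x i.+1 t + y i.+1 t) * (x i t - y i t) ^+ 2.
  apply: sumr_ge0 => i _; apply: mulr_ge0; last exact: sqr_ge0.
  apply: mulr_ge0; last by rewrite addr_ge0.
  by rewrite mulr_ge0 ?exprn_ge0 ?invr_ge0 // ltW.
pose p := 2 * 2^-1 ^+ n * r ^+ (3 * n).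
have p0 : 0 <= p by rewrite !mulr_ge0 ?exprn_ge0 ?invr_ge0 // ltW.
have pE : p = 2 * (r ^+ 3 / 8) ^+ n * 2 ^+ (2 * n).
  rewrite /p expr_div_n exprVn exprM (exprM 2 2 n).
  have -> : (8 : R) ^+ n = 2 ^+ n * (2 ^+ 2) ^+ n.
    by rewrite -exprMn; congr (_ ^+ n); rewrite !exprS expr0; ring.
  have h2 : (2 : R) ^+ n != 0 by rewrite expf_neq0.
  have h4 : ((2 : R) ^+ 2) ^+ n != 0 by rewrite !expf_neq0.
  move: h2 h4; move: ((r ^+ 3) ^+ n) (2 ^+ n) ((2 ^+ 2) ^+ n) => q u v h2 h4.
  by field; rewrite h2 h4.
have leak : - (p * (x n t - y n t) * (x n t * x n.+1 t - y n t * y n.+1 t)) <=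
    2 * M * (r ^+ 3 / 8) ^+ n * (enstrophy x n t + enstrophy y n t).
  have xn := xK n.+1 t tT; have yn := yK n.+1 t tT.
  have h1 : - ((x n t - y n t) * (x n t * x n.+1 t - y n t * y n.+1 t)) <=
      M * (x n t ^+ 2 + y n t ^+ 2).
    have a1 := mulr_ge0 (x0 n t) (y0 n t).
    have a2 : x n t * y n t * (x n.+1 t + y n.+1 t) <= x n t * y n t * M.
      by apply: ler_wpM2l => //; rewrite /M; lra.
    have a3 := mulr_ge0 M0 (sqr_ge0 (x n t - y n t)).
    have a4 := mulr_ge0 (sqr_ge0 (x n t)) (x0 n.+1 t).
    have a5 := mulr_ge0 (sqr_ge0 (y n t)) (y0 n.+1 t).
    have a6 := mulr_ge0 M0 a1.
    nra.
  have h2 : 2 ^+ (2 * n) * (x n t ^+ 2 + y n t ^+ 2) <= enstrophy x n t + enstrophy y n t.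
    rewrite mulrDr; apply: lerD; rewrite /enstrophy big_ord_recr /= lerDr;
      by apply: sumr_ge0 => i _; rewrite mulr_ge0 ?sqr_ge0 ?exprn_ge0.
  have q0 : 0 <= 2 * M * (r ^+ 3 / 8) ^+ n.
    by rewrite !mulr_ge0 // exprn_ge0 //; case/andP : r3_8.
  apply: le_trans (ler_wpM2l q0 h2).
  have := ler_wpM2l p0 h1; rewrite pE; lra.
have q0 : 0 <= (r ^+ 3 / 8) ^+ n * (enstrophy x n t + enstrophy y n t).
  rewrite mulr_ge0 ?addr_ge0 ?(enstrophy_ge0 x) ?(enstrophy_ge0 y) //.
  by rewrite exprn_ge0 //; case/andP : r3_8.
have t1 : 1 <= 1 + 2 * nu * t by rewrite lerDl !mulr_ge0 // ltW.
have t2 : 1 + 2 * nu * t <= 1 + 2 * nu * T.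
  by rewrite lerD2l; apply: ler_wpM2l => //; rewrite mulr_ge0 // ltW.
have dw_le : dw t <= 2 * M * ((r ^+ 3 / 8) ^+ n * (enstrophy x n t + enstrophy y n t)) - 2 * nu * w t.
  rewrite dwE comparison_identity -/p.
  have := ler_wpM2l (ltW nu0) visc; lra.
have s1 := ler_wpM2l (le_trans ler01 t1) dw_le.
have s2 : (1 + 2 * nu * t) * (2 * M * ((r ^+ 3 / 8) ^+ n * (enstrophy x n t + enstrophy y n t)))
    <= g t.
  have M2 : 0 <= 2 * M by rewrite mulr_ge0.
  by have := ler_wpM2r (mulr_ge0 M2 q0) t2; rewrite /g /k; lra.
have s3 : 0 <= nu * (2 * nu * t) * w t by rewrite !mulr_ge0 // ltW.
lra.
Qed.

End Viscous.

(** * The limit state of a viscous solution *)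

Section ViscousLimit.
Context {R : realType}.
Variables (r nu f0 B : R) (x : nat -> R -> R).
Hypotheses (r0 : 0 < r) (r6 : r ^+ 6 <= 32) (nu0 : 0 < nu) (f00 : 0 <= f0).
Hypothesis solx : regular_solution r nu f0 x.
Hypothesis xB : forall n, \sum_(j < n) x j 0 ^+ 2 <= B.

Let cx j : continuous (x j). Proof. exact: (rs_cont solx). Qed.

Let x0 j t : 0 <= x j t. Proof. exact: (rs_ge0 solx). Qed.

(** Comparing the solution with its own translates, which start from data of
    uniformly bounded energy, gives Cauchy's criterion. *)
Lemma viscous_cvg j : cvg (x j t @[t --> +oo]).
Proof.
set E := B + f0 ^+ 2 / nu ^+ 2.
have xE n t : 0 <= t -> \sum_(i < n) x i t ^+ 2 <= E.
  by exact: (viscous_energy_bounded r0 nu0 solx xB).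
apply: cauchy_cvg; apply: cauchy_exP => e e0.
have E0 : 0 <= B + E.
  have := xE 0%N 0 (lexx _); have := xB 0%N; rewrite !big_ord0; exact: addr_ge0.
(* Makes the bound (B + E) 2^j / (1 + 2 nu T) of the contraction less than e^2. *)
pose T := (B + E) * 2 ^+ j / (e ^+ 2 * (2 * nu)).
have en : 0 < e ^+ 2 * (2 * nu) by rewrite !mulr_gt0 ?exprn_gt0.
have T0 : 0 <= T by rewrite divr_ge0 ?mulr_ge0 ?exprn_ge0 // ltW.
exists (x j T); change (\forall t \near +oo, ball (x j T) e (x j t)).
near=> t.
have tT : T <= t by near: t; apply: nbhs_pinfty_ge; rewrite num_real.
have h0 : 0 <= t - T by rewrite subr_ge0.
have soly := translate_solution h0 solx (fun n => xE n _ h0).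
have := viscous_contraction r0 r6 nu0 f00 solx xB soly (By := E) _ j T0.
rewrite (addrC T) subrK => /(_ _)h.
have {}h : (1 + 2 * nu * T) * (2^-1 ^+ j * (x j T - x j t) ^+ 2) <= B + E.
  by apply: h => n; rewrite add0r; exact: xE.
rewrite /ball /= -(@ltr_pXn2r _ 2) ?nnegrE ?normr_ge0 ?(ltW e0) // real_normK ?num_real //.
have p0 : 0 < 2 * nu * T + 1 by rewrite ltr_wpDl // mulr_ge0 // mulr_ge0 // ltW.
have T1 : (B + E) * 2 ^+ j < e ^+ 2 * (1 + 2 * nu * T).
  have <- : T * (e ^+ 2 * (2 * nu)) = (B + E) * 2 ^+ j by rewrite divfK // gt_eqF.
  by have := exprn_gt0 2 e0; lra.
have j0 : 0 < (2 : R) ^+ j by rewrite exprn_gt0.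
have p0' : 0 < 1 + 2 * nu * T by rewrite addrC.
rewrite -(ltr_pM2l p0').
apply: le_lt_trans (_ : _ <= (B + E) * 2 ^+ j) _; last by rewrite [ltRHS]mulrC.
rewrite -ler_pdivrMr //; apply: le_trans h.
by rewrite exprVn le_eqVlt; apply/orP; left; apply/eqP; ring.
Unshelve. all: by end_near. Qed.

Definition xlim j : R := lim (x j t @[t --> +oo]).

Lemma xlim_cvg j : x j t @[t --> +oo] --> xlim j.
Proof. exact: viscous_cvg. Qed.

Let lim_cvg := xlim_cvg.

Lemma xlim_ge0 j : 0 <= xlim j.
Proof. by apply: limr_ge; [exact: viscous_cvg | near=> t; exact: x0].
Unshelve. all: by end_near. Qed.

Let sq_cvg j : x j t ^+ 2 @[t --> +oo] --> xlim j ^+ 2.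
Proof. by rewrite expr2; under eq_fun do rewrite expr2; apply: cvgM. Qed.

Let enstrophy_cvg n :
  enstrophy x n t @[t --> +oo] --> \sum_(j < n.+1) 2 ^+ (2 * j) * xlim j ^+ 2.
Proof.
rewrite /enstrophy; elim: n.+1 => [|m ih].
  rewrite big_ord0; under eq_fun do rewrite big_ord0; exact: cvg_cst.
rewrite big_ord_recr; under eq_fun do rewrite big_ord_recr.
apply: cvgD => //; apply: cvgM; [exact: cvg_cst | exact: sq_cvg].
Qed.

Let flux_cvg n : flux r (x^~ t) n @[t --> +oo] --> flux r xlim n.
Proof.
by apply: cvgM => //; apply: cvgM; [exact: cvg_cst | exact: sq_cvg].
Qed.

Let enstrophy_lim n : R := \sum_(j < n.+1) 2 ^+ (2 * j) * xlim j ^+ 2.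

(** The power balance passes to the limit because its time average tends to
    zero, the energy being bounded. *)
Let limit_balance n :
  f0 * xlim 0%N = flux r xlim n + nu * enstrophy_lim n.
Proof.
pose g t := 2 * (f0 * x 0%N t - flux r (x^~ t) n - nu * enstrophy x n t).
have [_ cg _] := energy_C1 solx n.
pose l := 2 * (f0 * xlim 0%N - flux r xlim n - nu * enstrophy_lim n).
have gl : g t @[t --> +oo] --> l.
  apply: cvgM; first exact: cvg_cst.
  apply: cvgB; last by apply: cvgM; [exact: cvg_cst | exact: enstrophy_cvg].
  by apply: cvgB => //; apply: cvgM; [exact: cvg_cst | exact: lim_cvg].
have avg := average_of_limit cg gl.
set E := B + f0 ^+ 2 / nu ^+ 2.
have xE m t : 0 <= t -> \sum_(i < m) x i t ^+ 2 <= E.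
  by exact: (viscous_energy_bounded r0 nu0 solx xB).
have avg0 : T^-1 * prim g T @[T --> +oo] --> 0.
  apply/cvgrPdist_le => e e0; near=> T.
  have T0 : 0 < T by near: T; exact: nbhs_pinfty_gt.
  have TE : E / e <= T by near: T; apply: nbhs_pinfty_ge; rewrite num_real.
  rewrite (primE (energy_C1 solx n) (ltW T0)) sub0r normrN normrM.
  rewrite gtr0_norm ?invr_gt0 // mulrC ler_pdivrMr //.
  apply: le_trans (_ : _ <= E) _; last by rewrite [leRHS]mulrC -ler_pdivrMr.
  have s0 t : 0 <= \sum_(i < n.+1) x i t ^+ 2 by apply: sumr_ge0 => i _; exact: sqr_ge0.
  have := xE n.+1 T (ltW T0); have := xE n.+1 0 (lexx _); have := s0 0; have := s0 T.
  by rewrite ler_norml => *; apply/andP; split; lra.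
have : l = 0 by exact: (cvg_unique _ avg avg0).
by rewrite /l; lra.
Unshelve. all: by end_near. Qed.

Let r3_8 : 0 <= r ^+ 3 / 8 < 1. Proof. exact: cube_ratio_lt1. Qed.

(** No energy leaks to infinity in the limit state: its enstrophy is finite,
    which forces the flux through the n-th component to vanish. *)
Lemma limit_enstrophy :
  nu * enstrophy_lim n @[n --> \oo] --> f0 * xlim 0%N.
Proof.
pose K := f0 * xlim 0%N / nu.
have fl0 n : 0 <= flux r xlim n.
  by rewrite /flux; apply: mulr_ge0; [rewrite mulr_ge0 ?sqr_ge0 ?exprn_ge0 // ltW | exact: xlim_ge0].
have HK n : 2 ^+ (2 * n) * xlim n ^+ 2 <= K.
  rewrite ler_pdivlMr // mulrC (limit_balance n) -[leLHS]add0r; apply: lerD => //.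
  apply: ler_wpM2l; first exact: ltW.
  rewrite /enstrophy_lim big_ord_recr lerDr.
  by apply: sumr_ge0 => i _; rewrite mulr_ge0 ?sqr_ge0 ?exprn_ge0.
have K0 : 0 <= K by apply: le_trans (HK 0%N); rewrite mulr_ge0 ?sqr_ge0 ?exprn_ge0.
have flb n : flux r xlim n <= K * (1 + K) * (r ^+ 3 / 8) ^+ n.
  have h4 : 0 < (2 : R) ^+ (2 * n) by rewrite exprn_gt0.
  have h2 : 0 < (2 : R) ^+ n by rewrite exprn_gt0.
  have b1 : 2 ^+ n * xlim n.+1 <= 1 + K.
    have := HK n.+1; rewrite mulnC exprM -exprMn.
    have -> : 2 ^+ n * xlim n.+1 = (2 ^+ n.+1 * xlim n.+1) / 2 by rewrite exprS; field.
    have : 0 <= 2 ^+ n.+1 * xlim n.+1 by rewrite mulr_ge0 ?xlim_ge0 ?exprn_ge0.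
    move: (_ * _) => z z0; have := sqr_ge0 (z - 1); nra.
  have -> : flux r xlim n = (r ^+ 3 / 8) ^+ n *
      ((2 ^+ (2 * n) * xlim n ^+ 2) * (2 ^+ n * xlim n.+1)).
    rewrite /flux exprM expr_div_n.
    have -> : (8 : R) ^+ n = 2 ^+ n * 2 ^+ (2 * n).
      by rewrite (exprM 2 2 n) -exprMn; congr (_ ^+ n); rewrite !exprS expr0; ring.
    move: h4 h2; move: (2 ^+ (2 * n)) (2 ^+ n) ((r ^+ 3) ^+ n) => u v w u0 v0.
    by field; rewrite !gt_eqF.
  rewrite mulrC; apply: ler_wpM2r; first by rewrite exprn_ge0 //; case/andP : r3_8.
  apply: ler_pM => //; first by rewrite mulr_ge0 ?sqr_ge0 ?exprn_ge0.
  by rewrite mulr_ge0 ?xlim_ge0 ?exprn_ge0.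
have fl_cvg : flux r xlim n @[n --> \oo] --> 0.
  apply: (@squeeze_cvgr _ _ _ _ (fun=> 0) (fun n => K * (1 + K) * (r ^+ 3 / 8) ^+ n)).
  - by near=> n; rewrite fl0 flb.
  - exact: cvg_cst.
  - exact: cvg_geom0.
rewrite (_ : (fun n => _) = (fun n => f0 * xlim 0%N - flux r xlim n)); last first.
  by apply/funext => n; rewrite (limit_balance n); ring.
rewrite -[X in _ --> X]subr0; apply: cvgB => //; exact: cvg_cst.
Unshelve. all: by end_near. Qed.

(** Each partial sum of the dissipation gives a lower bound of the averages and,
    by the energy inequality, the work of the force gives an upper bound; the
    energy equality of the limit state makes the two bounds meet. *)
Lemma viscous_average (a : R -> nat -> R) : (forall t, 0 <= t -> a t = x^~ t) ->
  average_viscous_dissipation nu a (f0 * xlim 0%N).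
Proof.
move=> ax; rewrite /average_viscous_dissipation.
pose h j t := nu * (2 ^+ (2 * j) * x j t ^+ 2).
have ch j : continuous (h j) by rewrite /h; cont_tac; exact: cx.
have h0 j t : 0 <= h j t.
  by apply: mulr_ge0; [exact: ltW | rewrite mulr_ge0 ?sqr_ge0 ?exprn_ge0].
set I := fun T => (\int[lebesgue_measure]_(t in `[0%R, T]) (nu%:E * H1_sqnorm (a t)))%E.
have IE T : 0 <= T -> (I T = \sum_(0 <= j <oo) (prim (h j) T)%:E)%E.
  move=> T0; transitivity (\int[lebesgue_measure]_(t in `[0%R, T])
      (\sum_(0 <= j <oo) (h j t)%:E))%E.
    apply: eq_integral => t; rewrite inE /= in_itv /= => /andP[t0 _].
    rewrite /H1_sqnorm ax // -nneseriesZl; last first.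
      by move=> i _; rewrite lee_fin mulr_ge0 ?sqr_ge0 ?exprn_ge0.
    by apply: eq_eseriesr => i _; rewrite -EFinM.
  rewrite integral_nneseries //=.
  - by apply: eq_eseriesr => i _; rewrite integral_prim.
  - move=> j; apply/measurable_EFinP; apply: measurable_funTS.
    exact: continuous_measurable_fun.
  - by move=> j t _; rewrite lee_fin.
have p0 j T : 0 <= prim (h j) T by apply: prim_ge0.
have sumE n T : 0 <= T -> \sum_(j < n.+1) prim (h j) T = nu * prim (enstrophy x n) T.
  move=> T0; rewrite -primZ; last exact: (cont_enstrophy solx).
  by rewrite -prim_sum //; congr prim; apply/funext => t; rewrite mulr_sumr.
have lo n T : 0 <= T -> ((nu * prim (enstrophy x n) T)%:E <= I T)%E.
  move=> T0; rewrite IE // -sumE //.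
  have nn i : (0 <= (prim (h i) T)%:E)%E by rewrite lee_fin.
  have := @nneseries_lim_ge R (fun i => (prim (h i) T)%:E) xpredT 0 n.+1 (fun i _ _ => nn i).
  by rewrite big_mkord sumEFin.
have up T : 0 <= T -> (I T <= (2^-1 * energy_budget f0 x B T)%:E)%E.
  move=> T0; rewrite IE //; apply: lime_le.
    by apply: is_cvg_nneseries => n _ _; rewrite lee_fin.
  near=> n; rewrite big_mkord sumEFin lee_fin.
  apply: (@le_trans _ _ (\sum_(j < n.+1) prim (h j) T)).
    by rewrite big_ord_recr /= lerDl.
  rewrite sumE //; have := enstrophy_int_le r0 solx xB n T0; lra.
have fin T : 0 <= T -> (I T \is a fin_num)%E.
  move=> T0; apply/fin_real/andP; split.
    by apply: lt_le_trans (lo 0%N T T0); rewrite ltNyr.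
  by apply: le_lt_trans (up T T0) _; rewrite ltry.
apply/fine_cvgP; split.
  near=> T; rewrite fin_numM //; apply: fin.
  by near: T; apply: nbhs_pinfty_ge; rewrite num_real.
have upavg : T^-1 * (2^-1 * energy_budget f0 x B T) @[T --> +oo] --> f0 * xlim 0%N.
  have a1 := average_of_limit (@cx 0%N) (@lim_cvg 0%N).
  rewrite (_ : (fun T => _) = fun T : R => 2^-1 * B * T^-1 + f0 * (T^-1 * prim (x 0%N) T)); last first.
    by apply/funext => T; rewrite /energy_budget; lra.
  rewrite -[X in _ --> X]add0r; apply: cvgD.
    rewrite -[X in _ --> X](mulr0 (2^-1 * B)).
    by apply: cvgM; [exact: cvg_cst | exact: cvg_invy0].
  by apply: cvgM; [exact: cvg_cst | exact: a1].
apply/cvgrPdist_le => e e0.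
have e2 : 0 < e / 2 by rewrite divr_gt0.
have [n _ /(_ n (leqnn n)) hn] : \forall n \near \oo,
    `|f0 * xlim 0%N - nu * enstrophy_lim n| <= e / 2.
  by have /cvgrPdist_le := limit_enstrophy; apply.
have loavg : T^-1 * (nu * prim (enstrophy x n) T) @[T --> +oo] --> nu * enstrophy_lim n.
  have cE : continuous (fun t => nu * enstrophy x n t).
    by cont_tac; exact: (cont_enstrophy solx).
  rewrite (_ : (fun T => _) = fun T : R => T^-1 * prim (fun t => nu * enstrophy x n t) T).
    by apply: average_of_limit => //; apply: cvgM; [exact: cvg_cst | exact: enstrophy_cvg].
  by apply/funext => T; rewrite primZ //; exact: (cont_enstrophy solx).
near=> T.
have T0 : 0 < T by near: T; exact: nbhs_pinfty_gt.
have h1 : `|f0 * xlim 0%N - T^-1 * (2^-1 * energy_budget f0 x B T)| <= e / 2.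
  by near: T; move/cvgrPdist_le : upavg; apply.
have h2 : `|nu * enstrophy_lim n - T^-1 * (nu * prim (enstrophy x n) T)| <= e / 2.
  by near: T; move/cvgrPdist_le : loavg; apply.
have := lo n T (ltW T0); have := up T (ltW T0).
rewrite /= -/(I T) -[I T]fineK ?fin ?(ltW T0) // !lee_fin -EFinM /= => u l.
have Ti : 0 <= T^-1 by rewrite invr_ge0 ltW.
have := ler_wpM2l Ti u; have := ler_wpM2l Ti l.
move: hn h1 h2; rewrite !ler_norml => /andP[? ?] /andP[? ?] /andP[? ?] ? ?.
by apply/andP; split; lra.
Unshelve. all: by end_near. Qed.

End ViscousLimit.

(** The quadratic deviation from the inviscid fixed point grows at most like
    [nu * fixpt_budget] per unit of time, so its limit is of the order of the
    viscosity. *)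
Lemma xlim_near_fixpt (R : realType) (r A nu B : R) (x : nat -> R -> R) :
  0 < r -> 0 < A -> 2 < r ^+ 2 -> r ^+ 6 <= 32 -> 0 < nu ->
  regular_solution r nu (A ^+ 2 / r) x ->
  (forall n, \sum_(j < n) x j 0 ^+ 2 <= B) ->
  A / r * (xlim x 0%N - A) ^+ 2 <= nu * fixpt_budget r A.
Proof.
move=> r0 A0 r2 r6 nu0 solx xB.
have f00 : 0 <= A ^+ 2 / r by rewrite divr_ge0 ?sqr_ge0 ?ltW.
have cx := rs_cont solx (j := 0%N).
have cl := xlim_cvg r0 r6 nu0 f00 solx xB (j := 0%N).
have cd : continuous (fun t => (x 0%N t - A) ^+ 2) by cont_tac.
have dl : (x 0%N t - A) ^+ 2 @[t --> +oo] --> (xlim x 0%N - A) ^+ 2.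
  rewrite expr2; under eq_fun do rewrite expr2.
  by apply: cvgM; apply: cvgB => //; exact: cvg_cst.
have avg := average_of_limit cd dl.
have l1 : A / r * (T^-1 * prim (fun t => (x 0%N t - A) ^+ 2) T) @[T --> +oo] -->
    A / r * (xlim x 0%N - A) ^+ 2 by apply: cvgM => //; exact: cvg_cst.
have l2 : (B + fixpt_budget r A) * T^-1 + nu * fixpt_budget r A @[T --> +oo] -->
    nu * fixpt_budget r A.
  rewrite -[X in _ --> X]add0r; apply: cvgD; last exact: cvg_cst.
  rewrite -[X in _ --> X](mulr0 (B + fixpt_budget r A)).
  by apply: cvgM; [exact: cvg_cst | exact: cvg_invy0].
apply: (ler_cvg_to l1 l2); near=> T.
have T0 : 0 < T by near: T; exact: nbhs_pinfty_gt.
have := fixpt_attraction r0 A0 r2 r6 (ltW nu0) solx xB 1 (ltW T0).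
rewrite (_ : (fun t => \sum_(j < 1) _) = fun t => (x 0%N t - A) ^+ 2); last first.
  by apply/funext => t; rewrite big_ord1 /fixpt expr0 divr1.
have Ti : 0 <= T^-1 by rewrite invr_ge0 ltW.
move=> /(ler_wpM2l Ti); rewrite mulrCA => h; apply: le_trans h _.
rewrite le_eqVlt; apply/orP; left; apply/eqP; field; by rewrite gt_eqF.
Unshelve. all: by end_near. Qed.

(** * Dissipation anomaly *)

Section InviscidModel.
Context {R : realType}.
Variables (c f0 A : R).
Let r : R := 2 `^ (c / 3).
Hypotheses (f00 : 0 < f0) (A0 : 0 < A) (r0 : 0 < r) (r2 : 2 < r ^+ 2) (r6 : r ^+ 6 <= 32).
Hypothesis f0E : f0 = A ^+ 2 / r.

Lemma fixpt_solution : nneg_dyadic_solution c 0 (force0 f0) (fun=> fixpt r A).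
Proof.
split; last by move=> j; exact: (fixpt_ge0 r0 A0).
split.
  move=> t _; apply: nondecreasing_is_cvgn.
    apply/nondecreasing_seqP => k; rewrite /series /= big_nat_recr //=.
    by rewrite lerDl sqr_ge0.
  exists (fixpt_budget r A) => _ [n _ <-]; rewrite /series /= big_mkord.
  apply: le_trans (fixpt_sum_le r0 A0 r2 n); apply: ler_sum => j _.
  by rewrite ler_peMl ?sqr_ge0 // exprn_ege1 // ler1n.
exists (fun _ _ => 0); split => [j t _|j|j t _].
- rewrite /is_derive_nneg (_ : (fun s => _) = fun=> 0); first exact: cvg_cst.
  by apply/funext => s; rewrite subrr mul0r.
- by move=> t; exact: cvg_cst.
- have := fixpt_stationary A r0 j; rewrite -f0E /transport /inflow powR2_exp -/r.
  by case: j => [|j]; rewrite ?powR2_exp -/r; lra.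
Qed.

(** The mass of the times up to [T] is the work of the force minus the variation
    of the energy, which stays bounded. *)
Lemma inviscid_average_dissipation a : nneg_dyadic_solution c 0 (force0 f0) a ->
  exists mu : {measure set (measurableTypeR R) -> \bar R},
    anomalous_dissipation (force0 f0) a mu /\
    ((T^-1)%:E * mu `]0%R, T]%classic @[T --> +oo%R] --> (f0 * A)%:E)%E.
Proof.
move=> sa; have sola := regularize (ltW f00) sa.
set x := (fun j (t : R) => a (Num.max 0 t) j) in sola.
have xmax j t : x j (Num.max 0 t) = x j t by rewrite /x maxA maxxx.
have xl2 t : l2 (x^~ t).
  by case: sa => [[al2 _] _]; apply: al2; rewrite le_max lexx.
have solx : regular_solution r 0 (A ^+ 2 / r) x by rewrite -f0E.
have ax t : 0 < t -> a t = x^~ t.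
  by move=> t0; apply/funext => j; rewrite /x (max_idPr (ltW t0)).
exists (dissipation_measure r0 sola xmax xl2); split.
  exact: dissipation_measureP.
have [B xB] := rs_l2 solx.
have [C xC] := inviscid_energy_bounded r0 A0 r2 r6 solx xB.
have lim_avg := inviscid_average r0 A0 r2 r6 solx xB.
have sq_lim : 2^-1 * (T^-1 * (sqn x 0 - sqn x T)) @[T --> +oo] --> 0.
  rewrite -[X in _ --> X](mulr0 2^-1); apply: cvgM; first exact: cvg_cst.
  pose K := `|sqn x 0| + C.
  apply/cvgrPdist_le => e e0; near=> T.
  have T1 : 1 <= T by near: T; apply: nbhs_pinfty_ge; rewrite num_real.
  have T0 : 0 < T by exact: lt_le_trans T1.
  have TK : K / e <= T by near: T; apply: nbhs_pinfty_ge; rewrite num_real.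
  rewrite sub0r normrN normrM gtr0_norm ?invr_gt0 // mulrC ler_pdivrMr //.
  apply: le_trans (_ : _ <= K) _; last by rewrite [leRHS]mulrC -ler_pdivrMr.
  apply: le_trans (ler_normB _ _) _; rewrite lerD2l ger0_norm.
    by apply: l2_sqnorm_le => // n; exact: xC.
  by apply: le_trans (l2_partial_le 0 (@xl2 T)); rewrite big_ord0.
have L : f0 * (T^-1 * prim (x 0%N) T) + 2^-1 * (T^-1 * (sqn x 0 - sqn x T))
    @[T --> +oo] --> f0 * A.
  rewrite -[X in _ --> X]addr0; apply: cvgD => //.
  by apply: cvgM; [exact: cvg_cst | exact: lim_avg].
have LE : (f0 * (T^-1 * prim (x 0%N) T) + 2^-1 * (T^-1 * (sqn x 0 - sqn x T)))%:E
    @[T --> +oo] --> (f0 * A)%:E by apply: cvg_EFin => //; exact: nearW.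
apply: cvg_trans LE; apply: near_eq_cvg; near=> T.
have T0 : 0 <= T by near: T; apply: nbhs_pinfty_ge; rewrite num_real.
rewrite dissipation_measure_itv // -EFinM /dissipated prim0; congr (_%:E).
by ring.
Unshelve. all: by end_near. Qed.

End InviscidModel.

Unset Implicit Arguments.
Set Strict Implicit.

Theorem theorem4p2 (R : realType) (c f0 : R) (hc1 : 3 / 2 < c)
    (hc2 : c <= 5 / 2) (hf0 : 0 < f0) :
  exists eps_d : R,
    [/\ average_anomalous_dissipation c (force0 f0) eps_d,
        0 < eps_d
      & forall a : R -> R -> nat -> R,
          (forall nu : R, 0 < nu ->
             nneg_dyadic_solution c nu (force0 f0) (a nu)) ->
          exists D : R -> R,
            (forall nu : R, 0 < nu ->
               average_viscous_dissipation nu (a nu) (D nu)) /\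
            D nu @[nu --> 0^'+] --> eps_d].
Proof.
have [r0 r2 r6] := root_scale_bounds hc1 hc2.
set r := 2 `^ (c / 3) in r0 r2 r6.
pose A := Num.sqrt (f0 * r).
have A0 : 0 < A by rewrite sqrtr_gt0 mulr_gt0.
have f0E : f0 = A ^+ 2 / r by rewrite sqr_sqrtr ?mulr_ge0 ?mulfK ?gt_eqF // ltW.
exists (f0 * A); split; last 1 first.
- move=> a asol; pose x nu j t := a nu (Num.max 0 t) j.
  have solx nu : 0 < nu -> regular_solution r nu f0 (x nu).
    by move=> nu0; apply: regularize; [exact: ltW | exact: asol].
  exists (fun nu => f0 * xlim (x nu) 0%N); split => [nu nu0|].
    have [B xB] := rs_l2 (solx nu nu0).
    apply: (viscous_average r0 r6 nu0 (ltW hf0) (solx nu nu0) xB) => t t0.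
    by apply/funext => j; rewrite /x (max_idPr t0).
  apply: cvgM; first exact: cvg_cst.
  apply/cvgrPdist_le => e e0.
  pose k := fixpt_budget r A / (A / r).
  have Ar : 0 < A / r by rewrite divr_gt0.
  near=> nu.
  have nu0 : 0 < nu by near: nu; exact: nbhs_right_gt.
  have nuk : nu * k <= e ^+ 2.
    have k1 : 0 < `|k| + 1 by rewrite ltr_wpDl.
    have : nu < e ^+ 2 / (`|k| + 1).
      by near: nu; apply: nbhs_right_lt; rewrite divr_gt0 ?exprn_gt0.
    rewrite ltr_pdivlMr // => /ltW; apply: le_trans; apply: ler_wpM2l; first exact: ltW.
    by apply: le_trans (ler_norm k) _; rewrite lerDl.
  have [B xB] := rs_l2 (solx nu nu0).
  have := solx nu nu0; rewrite {1}f0E => sx.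
  have := xlim_near_fixpt r0 A0 r2 r6 nu0 sx xB.
  rewrite mulrC -ler_pdivlMr // -mulrA -/k => h.
  rewrite distrC -(@ler_pXn2r _ 2) ?nnegrE ?normr_ge0 ?(ltW e0) // real_normK ?num_real //.
  exact: le_trans nuk.
- split; first by exists (fun=> fixpt r A); exact: fixpt_solution.
  by move=> a sa; exact: (inviscid_average_dissipation hf0 A0 r0 r2 r6 f0E sa).
- by rewrite mulr_gt0.
Unshelve. all: by end_near. Qed.
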